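(* Let $k=\mathbb{C}$ and let $\nu$ be a plane divisorial valuation of the quotient field of $R=\mathcal{O}_{\mathbb{P}^2,p}$ centered at $R$. Let $d_m$ and the last maximal contact value $\overline{\beta}_{g+1}$ be the integers attached to $\nu$ in the context, and let $\{g_j\}_{j=0}^{n+1}$ be the sequence of key forms of $\nu$ with respect to $\{x,y\}$. Then $-\nu(g_{n+1})\geq 0$ if and only if $d_m^2\geq\overline{\beta}_{g+1}$.
   Context: Let $\mathbb{P}^2=\mathbb{P}^2_{\mathbb{C}}$ with homogeneous coordinates $(T_0:T_1:T_2)$, $L$ the line $T_2=0$ (line at infinity), $p=(1:0:0)\in L$, $R=\mathcal{O}_{\mathbb{P}^2,p}$, and $x=T_0/T_2$, $y=T_1/T_2$ affine coordinates in the chart $T_2\neq 0$, so that $\mathbb{C}(x,y)$ is the quotient field of $R$. A plane divisorial valuation $\nu$ centered at $R$ corresponds to a finite simple sequence of point blowing-ups $\pi: X=X_m\xrightarrow{\pi_m}X_{m-1}\to\cdots\to X_1\xrightarrow{\pi_1}X_0=\mathbb{P}^2$, $m\ge 1$, where $\pi_1$ is the blowing-up at $p_1=p$ and, for $1\le i\le m-1$, $\pi_{i+1}$ is the blowing-up at a closed point $p_{i+1}$ of the exceptional divisor $E_i$ of $\pi_i$; $\nu$ is the order of vanishing along the last exceptional divisor $E_m$ (value group $\mathbb{Z}$). Let $\varphi_m$ be a general analytically irreducible germ of curve at $p$ whose strict transform on $X_m$ is transversal to $E_m$ at a non-singular point of the exceptional locus (general: its strict transform does not meet the strict transform of $L$).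 $d_m$ is the intersection multiplicity at $p$ of $L$ and $\varphi_m$, and $\mathrm{mult}_{p_j}(\varphi_m)$ is the multiplicity at $p_j$ of the strict transform of $\varphi_m$. The sequence of maximal contact values of $\nu$ is $\{\overline{\beta}_j\}_{j=0}^{g+1}$: $\overline{\beta}_0,\ldots,\overline{\beta}_g$ is the minimal generating set of the semigroup $\nu(R\setminus\{0\})$, and the last one is $\overline{\beta}_{g+1}=\nu(\varphi_m)=\sum_{j=1}^m \mathrm{mult}_{p_j}(\varphi_m)^2$. Key forms (Mondal). Put $\delta=-\nu$ (so $\delta(x)>0$). The key forms of $\nu$ (with respect to $\{x,y\}$) are the unique finite sequence $g_0,\ldots,g_{n+1}$ ($n\ge 0$) of elements of $\mathbb{C}[x,x^{-1},y]$ such that, with $\omega_j:=\delta(g_j)$: (P0) $g_0=x$, $g_1=y$. (P1) For $1\le j\le n$: $\omega_{j+1}<\alpha_j\omega_j=\sum_{i=0}^{j-1}\beta_{j,i}\omega_i$, where $\alpha_j=\min\{\alpha\in\mathbb{Z}_{>0}\mid \alpha\omega_j\in\mathbb{Z}\omega_0+\cdots+\mathbb{Z}\omega_{j-1}\}$ and the $\beta_{j,i}$ are integers with $0\le\beta_{j,i}<\alpha_i$ for $1\le i<j$ (and $\beta_{j,0}$ unrestricted). (P2) For $1\le j\le n$ there is $\theta_j\in\mathbb{C}\setminus\{0\}$ with $g_{j+1}=g_j^{\alpha_j}-\theta_j\,g_0^{\beta_{j,0}}\cdots g_{j-1}^{\beta_{j,j-1}}$. (P3) Let $y_1,\ldots,y_{n+1}$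 be indeterminates and $\omega$ the weighted degree on $B=\mathbb{C}[x,x^{-1},y_1,\ldots,y_{n+1}]$ giving weight $\omega_0$ to $x$ and $\omega_j$ to $y_j$. Then for every nonzero $h\in\mathbb{C}[x,x^{-1},y]$, $\delta(h)=\min\{\omega(G)\mid G\in B,\ G(x,g_1,\ldots,g_{n+1})=h\}$. *)

(* Defs.v *)
From HB Require Import structures.
From mathcomp Require Import all_boot all_order all_algebra.
From mathcomp Require Import boolp reals complex mpoly.

Set Implicit Arguments.
Unset Strict Implicit.
Unset Printing Implicit Defensive.

Import Order.TTheory GRing.Theory Num.Theory.
Local Open Scope ring_scope.

(* A record rather than a bare function type, so that the pointwise ring
   structure on functions cannot be inferred instead of this one. *)
Record series (R : Type) := Series { scoef :> nat -> R }.

HB.instance Definition _ (R : Type) := gen_eqMixin (series R).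
HB.instance Definition _ (R : Type) := gen_choiceMixin (series R).

Lemma seriesP (R : Type) (f g : series R) : (forall n, f n = g n) -> f = g.
Proof. by case: f g => [f] [g] /= /funext ->. Qed.

Section SeriesRing.
Variable R : comNzRingType.
Implicit Types f g h : series R.

Definition sconst (a : R) : series R := Series (fun n => if n == 0%N then a else 0).
Definition svar : series R := Series (fun n => (n == 1%N)%:R).
Definition sadd f g : series R := Series (fun n => f n + g n).
Definition sopp f : series R := Series (fun n => - f n).
Definition smul f g : series R :=
  Series (fun n => \sum_(i < n.+1) f i * g (n - i)%N).

Fact saddA : associative sadd.
Proof. by move=> f g h; apply: seriesP => n /=; rewrite addrA. Qed.
Fact saddC : commutative sadd.
Proof. by move=> f g; apply: seriesP => n /=; rewrite addrC. Qed.
Fact sadd0 : left_id (sconst 0) sadd.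
Proof. by move=> f; apply: seriesP => n /=; rewrite if_same add0r. Qed.
Fact saddN : left_inverse (sconst 0) sopp sadd.
Proof. by move=> f; apply: seriesP => n /=; rewrite addNr if_same. Qed.

HB.instance Definition _ :=
  GRing.isZmodule.Build (series R) saddA saddC sadd0 saddN.

Let trunc N f : {poly R} := \poly_(i < N) f i.

Let smul_trunc N f g n : (n < N)%N -> smul f g n = (trunc N f * trunc N g)`_n.
Proof.
move=> ltnN; rewrite coefM /=; apply: eq_bigr => i _.
have leiN : (i < N)%N by exact: leq_ltn_trans (leq_ord i) ltnN.
by rewrite !coef_poly leiN (leq_ltn_trans (leq_subr _ _) ltnN).
Qed.

Fact smulA : associative smul.
Proof.
move=> f g h; apply: seriesP => n.
rewrite (smul_trunc _ _ (ltnSn n)) [RHS](smul_trunc _ _ (ltnSn n)).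
transitivity ((trunc n.+1 f * (trunc n.+1 g * trunc n.+1 h))`_n).
  rewrite !coefM; apply: eq_bigr => i _; congr (_ * _).
  by rewrite coef_poly ltnS leq_subr (@smul_trunc n.+1) // ltnS leq_subr.
rewrite mulrA !coefM; apply: eq_bigr => i _; congr (_ * _).
by rewrite coef_poly ltn_ord (@smul_trunc n.+1) // ltn_ord.
Qed.
Fact smulC : commutative smul.
Proof.
move=> f g; apply: seriesP => n.
by rewrite !(smul_trunc _ _ (ltnSn n)) mulrC.
Qed.
Fact smul1 : left_id (sconst 1) smul.
Proof.
move=> f; apply: seriesP => n /=.
by rewrite big_ord_recl /= mul1r subn0 big1 ?addr0 // => i _; rewrite mul0r.
Qed.
Fact smulDl : left_distributive smul sadd.
Proof.
move=> f g h; apply: seriesP => n /=.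
by rewrite -big_split /=; apply: eq_bigr => i _; rewrite mulrDl.
Qed.
Fact sone_neq0 : sconst 1 != sconst 0 :> series R.
Proof.
by apply/eqP => /(congr1 (fun f : series R => f 0%N)) /= /eqP; rewrite oner_eq0.
Qed.

HB.instance Definition _ :=
  GRing.Zmodule_isComNzRing.Build (series R) smulA smulC smul1 smulDl sone_neq0.

End SeriesRing.

(* 0 if there is no such n. *)
Definition least (P : pred nat) : nat :=
  if pselect (exists n, P n) is left exP then ex_minn exP else 0%N.

(* Order of vanishing of a series along {variable = 0}. *)
Definition sorder (R : comNzRingType) (f : series R) : nat :=
  least (fun n => f n != 0).

Section Germs.
Variable k : fieldType.

(* k[[u,v]], the completed local ring of a smooth surface at a point with local
   coordinates u, v; f i j is the coefficient of u^i v^j. *)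
Definition germ := series (series k).

Implicit Types (f g : germ) (c q : option k) (pts : seq (option k)).

Definition gconst (a : k) : germ := sconst (sconst a).
Definition gu : germ := svar (series k).
Definition gv : germ := sconst (svar k).

Definition gunit f : Prop := exists g, f * g = 1.

Definition girreducible f : Prop :=
  ~ gunit f /\ forall g h, f = g * h -> gunit g \/ gunit h.

(* The intersection multiplicity is d: k[[u,v]]/(f,g) has dimension d over k. *)
Definition intersection_multiplicity f g (d : nat) : Prop :=
  exists e : 'I_d -> germ, forall h, exists! a : {ffun 'I_d -> k},
    exists r s : germ, h = \sum_(i < d) gconst (a i) * e i + r * f + s * g.

Definition multiplicity f : nat :=
  least (fun n => [exists i : 'I_n.+1, f i (n - i)%N != 0]).

(* The closed points of the exceptional divisor E of the blowing-up of a point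
   with local coordinates (u, v) are the elements of P^1(k): at the point Some c
   the local coordinates are (u', v') with u = u', v = u' (v' + c), and E is
   u' = 0; at the point None they satisfy u = u' v', v = v', and E is v' = 0. *)
Definition exceptional c : germ := if c is Some _ then gu else gv.

(* Pull-back (total transform), f(u', u' (v' + c)) resp. f(u' v', v'). *)
Definition total1 f c : germ :=
  match c with
  | Some a => Series (fun i => Series (fun j =>
      \sum_(b < i.+1) f (i - b)%N b * a ^+ (b - j) *+ 'C(b, j)))
  | None => Series (fun i => Series (fun j =>
      if (i <= j)%N then f i (j - i)%N else 0))
  end.

(* Strict transform: the total transform divided by the power of the equation
   of E whose exponent is the multiplicity of f. *)
Definition strict1 f c : germ :=
  let r := multiplicity f in
  match c with
  | Some _ => Series (fun i => Series (fun j => total1 f c (i + r)%N j))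
  | None => Series (fun i => Series (fun j => total1 f c i (j + r)%N))
  end.

(* For p_1 = p, a list [:: c_2; ...; c_m] encodes the points p_2, ..., p_m, where
   p_{i+1} is the point c_{i+1} of E_i, in the local coordinates at p_i obtained
   from those at p_1 by the rule above.  All lists occur, and m >= 1. *)
Definition total f pts : germ := foldl total1 f pts.
Definition strict f pts : germ := foldl strict1 f pts.

(* Order of vanishing along E_m, the exceptional divisor of the blowing-up at
   p_m, read off at the point Some 0 of E_m, where E_m is {u' = 0}. *)
Definition ord_Em pts f : nat := sorder (total1 (total f pts) (Some 0)).

(* The last maximal contact value is nu(phi_m), where nu is extended to the
   completion k[[u,v]] as the order of vanishing along E_m. *)
Definition last_maximal_contact_value pts (phi : germ) : nat := ord_Em pts phi.

(* At p = (1:0:0) the local coordinates are u = T1/T0 and v = T2/T0, so the line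
   at infinity L : T2 = 0 has the equation v. *)
Definition line_at_infinity : germ := gv.

Definition passes f : Prop := f 0%N 0%N = 0.

(* phi is a general analytically irreducible germ at p whose strict transform
   on X_m is transversal to E_m at a nonsingular point q of the exceptional
   locus: q lies on no strict transform of E_1, ..., E_{m-1}, nor on that of L. *)
Definition general_curvette pts (phi : germ) : Prop :=
  girreducible phi /\
  exists q : option k, let pts' := rcons pts q in
  [/\ intersection_multiplicity (strict phi pts') (exceptional q) 1,
      (forall i, (i < size pts)%N ->
         ~ passes (strict (exceptional (nth q pts' i)) (drop i.+1 pts')))
    & ~ passes (strict line_at_infinity pts')].

End Germs.

Section KeyForms.
Variable k : fieldType.

(* k[x,y] is {poly {poly k}}, the outer variable being x. *)
Definition funfield := {fraction {poly {poly k}}}.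

Definition fx : funfield := tofrac 'X.
Definition fy : funfield := tofrac ('X%:P).
Definition fconst (a : k) : funfield := tofrac (a%:P%:P).

(* A(u,v), the outer variable being u, at u = T1/T0 = y/x, v = T2/T0 = 1/x. *)
Definition at_p (A : {poly {poly k}}) : funfield :=
  (map_poly (map_poly fconst) A).[fy / fx, fx^-1].

Definition germ_of_poly (A : {poly {poly k}}) : germ k :=
  Series (fun i => Series (fun j => A`_i`_j)).

(* nu is the order of vanishing along E_m; every nonzero element of k(x,y) is a
   quotient as below.  The value of nu at 0 is irrelevant. *)
Definition divisorial_valuation (pts : seq (option k)) (nu : funfield -> int) :=
  forall A B : {poly {poly k}}, A != 0 -> B != 0 ->
    nu (at_p A / at_p B) =
      (ord_Em pts (germ_of_poly A))%:Z - (ord_Em pts (germ_of_poly B))%:Z.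

Definition laurent (h : funfield) : Prop :=
  exists (N : nat) (P : {poly {poly k}}), h = fx ^- N * tofrac P.

(* z is in the subgroup Z w_0 + ... + Z w_{j-1}. *)
Definition int_span (w : nat -> int) (j : nat) (z : int) : Prop :=
  exists a : nat -> int, z = \sum_(i < j) a i * w i.

Definition is_alpha (w : nat -> int) (j a : nat) : Prop :=
  [/\ (0 < a)%N, int_span w j (w j *+ a)
    & forall b, (0 < b)%N -> int_span w j (w j *+ b) -> (a <= b)%N].

(* An element of B = k[x, 1/x, y_1, ..., y_{n+1}] is x^(-N) Q with Q a polynomial
   in n+2 variables, the variable of index 0 being x. *)
Definition Beval n (g : nat -> funfield) (N : nat) (Q : {mpoly k[n.+2]}) :
    funfield :=
  fx ^- N * mmap fconst (fun i : 'I_n.+2 => g i) Q.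

Definition Bweight n (w : nat -> int) (N : nat) (m : 'X_{1..n.+2}) : int :=
  \sum_(i < n.+2) w i *+ m i - w 0%N *+ N.

(* d is the weighted degree of the nonzero element x^(-N) Q. *)
Definition is_wdeg n (w : nat -> int) (N : nat) (Q : {mpoly k[n.+2]}) (d : int) :=
  (forall m, m \in msupp Q -> Bweight w N m <= d) /\
  (exists2 m, m \in msupp Q & Bweight w N m = d).

(* g_0, ..., g_{n+1} are the key forms of nu; the values of g beyond n+1 play no
   role. *)
Definition key_forms (nu : funfield -> int) (n : nat) (g : nat -> funfield) :=
  let delta h := - nu h in
  let w j := delta (g j) in
  exists (alpha : nat -> nat) (beta : nat -> nat -> int) (theta : nat -> k),
  [/\ (forall j, (j <= n.+1)%N -> laurent (g j)),
      g 0%N = fx /\ g 1%N = fy,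
      (forall j, (1 <= j <= n)%N ->
         [/\ is_alpha w j (alpha j),
             w j.+1 < w j *+ alpha j,
             w j *+ alpha j = \sum_(i < j) beta j i * w i
           & forall i, (1 <= i < j)%N -> 0 <= beta j i < (alpha i)%:Z]),
      (forall j, (1 <= j <= n)%N ->
         theta j != 0 /\
         g j.+1 = g j ^+ alpha j
                  - fconst (theta j) * \prod_(i < j) g i ^ beta j i)
    & forall h, laurent h -> h != 0 ->
        (forall N (Q : {mpoly k[n.+2]}) d,
           Beval g N Q = h -> is_wdeg w N Q d -> delta h <= d) /\
        (exists N (Q : {mpoly k[n.+2]}),
           Beval g N Q = h /\ is_wdeg w N Q (delta h))].

End KeyForms.

(* Main.v *)
From HB Require Import structures.
Require Import Defs.
From mathcomp Require Import all_boot all_order all_algebra.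
From mathcomp Require Import boolp reals complex mpoly ring zify.

Set Implicit Arguments.
Unset Strict Implicit.
Unset Printing Implicit Defensive.

Import Order.TTheory GRing.Theory Num.Theory.
Local Open Scope ring_scope.

(** Near p use the coordinates u = T1 / T0 = y / x and v = T2 / T0 = 1 / x, so
    that L is v = 0.  Write nu(f) for the order along E_m of a germ f, let phi
    be the curvette and d = (L . phi).  Two facts carry the proof.

    The curvette.  One has nu(v) = d, and for every germ f that does not contain
    L, with (f . L) = r,

                     nu(f) * nu(v) <= r * nu(phi)

    ([general_curvette_data]).  This is the inequality
    G_ij G_jk <= G_ik G_jj between entries of the inverse of an intersection
    matrix.  It is proved by induction on the number of blowing-ups, going
    through the same inequality for the exceptional line in place of L; the
    inductive step [curvette_step] rests on the product of two nonnegative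
    factors in [step_inequality].  The induction also needs the strict transforms
    of phi to have a single tangent at each p_i.  Instead of factoring germs,
    this is obtained by constructing, from the strict transform at the last
    point back to p, germs with a single tangent that divide the successive
    transforms of phi ([blow_down], by Weierstrass division).  At p the germ so
    constructed divides phi, hence is phi up to a unit.

    The key forms.  With D_j the degree of g_(j+1) in y, the element
    P_j = x ^ (- D_j) * g_(j+1) is a polynomial in u and v that restricts to
    u ^ D_j on v = 0, and P_(j+1) = P_j ^ a_j - theta v ^ c P^b with c > 0
    ([key_system_exists]).  Put K_j = nu(P_j).  Then
    - nu(g_(j+1)) = D_j d - K_j, so the theorem says that
    K_n <= D_n d if and only if nu(phi) <= d ^ 2.

    If nu(phi) <= d ^ 2, the inequality for f = P_n, where r = D_n, gives
    K_n d <= D_n d ^ 2, that is, K_n <= D_n d.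

    Suppose conversely that K_n <= D_n d.  Since a_j K_j < K_(j+1), this descends
    to K_j <= D_j d for all j.  Let f in k[u, v] be a truncation of phi of high
    order.  Since - nu is computed by the least weight of an expression in the
    key forms, f is a combination of monomials v ^ s P_0 ^ e_0 ... P_n ^ e_n of
    value at least nu(f), where s may be negative.  Reducing each P_j ^ a_j by the
    recursion does not lower values and makes the exponents e_j digits of a mixed
    radix numeral; the monomials so obtained restrict to distinct powers of u on
    v = 0, so no negative power of v can remain in an element of k[u, v]
    ([value_normal_form]).  The restriction of phi to v = 0 has order d, so the
    monomial restricting to u ^ d occurs with s = 0.  Its value is at most d * d
    because K_j <= D_j d.  Hence nu(phi) > d ^ 2 is impossible. *)

(** * Formal power series over a domain *)

Section Least.
Implicit Types (P Q : pred nat).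

Lemma leastP P : (exists n, P n) ->
  P (least P) /\ forall n, P n -> (least P <= n)%N.
Proof.
move=> exP; rewrite /least; case: pselect => [ex|/(_ exP)//].
by case: ex_minnP.
Qed.

Lemma least_eq P m : P m -> (forall n, P n -> (m <= n)%N) -> least P = m.
Proof.
move=> Pm minm; have [|Pl minl] := @leastP P; first by exists m.
by apply/eqP; rewrite eqn_leq minl //= minm.
Qed.

End Least.

Section Series.
Variable R : comNzRingType.
Implicit Types (f g : series R).

Lemma scoefD f g n : (f + g) n = f n + g n. Proof. by []. Qed.
Lemma scoefN f n : (- f) n = - f n. Proof. by []. Qed.
Lemma scoefB f g n : (f - g) n = f n - g n. Proof. by []. Qed.
Lemma scoef0 n : (0 : series R) n = 0.
Proof. by case: n. Qed.
Lemma scoefM f g n : (f * g) n = \sum_(i < n.+1) f i * g (n - i)%N.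
Proof. by []. Qed.
Lemma scoef1 n : (1 : series R) n = (n == 0%N)%:R.
Proof. by case: n. Qed.
Lemma scoef_sum (I : Type) (r : seq I) (P : pred I) (F : I -> series R) n :
  (\sum_(i <- r | P i) F i) n = \sum_(i <- r | P i) F i n.
Proof.
by elim/big_rec2: _ => [|i x y _ <-]; rewrite ?scoef0.
Qed.

Lemma sconstM a f n : (sconst a * f) n = a * f n.
Proof.
rewrite scoefM big_ord_recl /= subn0 big1 ?addr0 // => i _.
by rewrite mul0r.
Qed.

Lemma svarM f n : (svar R * f) n = if n is m.+1 then f m else 0.
Proof.
rewrite scoefM; case: n => [|n]; first by rewrite big_ord1 /= mul0r.
rewrite 2!big_ord_recl /= mul0r add0r mul1r subSS subn0 big1 ?addr0 // => i _.
by rewrite /= mul0r.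
Qed.

Lemma svarXM r f n : (svar R ^+ r * f) n = if (n < r)%N then 0 else f (n - r)%N.
Proof.
elim: r n => [|r IH] n; first by rewrite expr0 mul1r subn0.
by rewrite exprS -mulrA svarM; case: n => [|n] //; rewrite IH ltnS subSS.
Qed.

Lemma scoefM0 f g : (f * g) 0%N = f 0%N * g 0%N.
Proof. by rewrite scoefM big_ord1. Qed.

Definition hasorder f r := (forall j, (j < r)%N -> f j = 0) /\ f r != 0.

Lemma hasorder_uniq f r s : hasorder f r -> hasorder f s -> r = s.
Proof.
move=> [fr fr0] [fs fs0]; case: (ltngtP r s) => // [/fs|/fr] E.
  by rewrite E eqxx in fr0.
by rewrite E eqxx in fs0.
Qed.

Lemma hasorder_ex f : f != 0 -> exists r, hasorder f r.
Proof.
move=> f0; have exP : exists n, f n != 0.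
  apply: contrapT => /forallNP f00; case/eqP: f0; apply: seriesP => n.
  by rewrite scoef0; apply/eqP/negP => /negP; apply: f00.
have [P minP] := leastP exP; exists (least (fun n => f n != 0)); split=> // j ltj.
apply/eqP/negP => /negP /minP; lia.
Qed.

Lemma hasorder_svar1 : hasorder (svar R) 1.
Proof.
split=> [j|]; last exact: oner_neq0.
by rewrite ltnS leqn0 => /eqP ->.
Qed.

Lemma hasorder_svar r f s : hasorder f s -> hasorder (svar R ^+ r * f) (r + s).
Proof.
move=> [f0 fs]; split=> [j|]; rewrite svarXM.
  by case: ifP => // rj ltj; apply: f0; lia.
by rewrite ltnNge leq_addr /= addKn.
Qed.

Lemma hasorder_svar_inv r f s : hasorder (svar R ^+ r * f) s ->
  (r <= s)%N /\ hasorder f (s - r).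
Proof.
move=> [f0]; rewrite svarXM; case: ifP; first by rewrite eqxx.
move=> rs fs; split; first by lia.
split=> // j ltj; have /(f0 _) : (r + j < s)%N by lia.
by rewrite svarXM ltnNge leq_addr /= addKn.
Qed.

Lemma hasorder_sorder f r : hasorder f r -> sorder f = r.
Proof.
move=> [f0 fr]; apply: least_eq => // n; apply: contraR; rewrite -ltnNge.
by move=> /f0 ->.
Qed.

End Series.

Lemma hasorderM (R : idomainType) (f g : series R) r s :
  hasorder f r -> hasorder g s -> hasorder (f * g) (r + s).
Proof.
move=> [f0 fr] [g0 gs].
have key n (i : 'I_n.+1) : (n < r + s)%N || ((n == r + s)%N && (i != r :> nat)) ->
    f i * g (n - i)%N = 0.
  move=> h; have [/f0 ->|ri] := ltnP i r; first by rewrite mul0r.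
  rewrite g0 ?mulr0 //; have := ltn_ord i; lia.
split=> [j ltj|]; rewrite scoefM.
  by apply: big1 => i _; apply: key; rewrite ltj.
have lr : (r < (r + s).+1)%N by lia.
rewrite (bigD1 (Ordinal lr)) //= big1 => [|i ne].
  by rewrite addr0 addKn mulf_neq0.
by apply: key; rewrite eqxx /=; apply/orP; right; apply: contra ne => /eqP e; apply/eqP/val_inj.
Qed.

Section SeriesDomain.
Variable R : idomainType.
Implicit Types f g : series R.

Definition series_unit : {pred series R} := fun f => `[< exists g, g * f = 1 >].
Definition series_inv f : series R :=
  if pselect (exists g, g * f = 1) is left ex then projT1 (cid ex) else f.

Fact series_mulVr : {in series_unit, left_inverse 1 series_inv *%R}.
Proof.
move=> f /asboolP ex; rewrite /series_inv; case: pselect => // ex'.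
exact: (projT2 (cid ex')).
Qed.

Fact series_unitPl f g : g * f = 1 -> f \in series_unit.
Proof. by move=> gf; apply/asboolP; exists g. Qed.

Fact series_inv_out : {in [predC series_unit], series_inv =1 id}.
Proof.
move=> f /negP nex; rewrite /series_inv; case: pselect => // ex.
by case: nex; apply/asboolP.
Qed.

HB.instance Definition _ := GRing.ComNzRing_hasMulInverse.Build (series R)
  series_mulVr series_unitPl series_inv_out.

Fact series_integral : GRing.integral_domain_axiom (series R).
Proof.
move=> f g fg; have [//|/hasorder_ex [r fr]] := eqVneq f 0.
have [//|/hasorder_ex [s gs]] := eqVneq g 0.
by have [_] := hasorderM fr gs; rewrite fg scoef0 eqxx.
Qed.

HB.instance Definition _ :=
  GRing.ComUnitRing_isIntegral.Build (series R) series_integral.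

End SeriesDomain.

(** * Blowing-ups as ring morphisms *)

Section Germs.
Variable k : fieldType.
Implicit Types (f g h : germ k) (a : k) (c q : option k) (p : {poly k}).

Lemma germP f g : (forall i j, f i j = g i j) -> f = g.
Proof. by move=> e; apply: seriesP => i; apply: seriesP => j. Qed.

Definition swap f : germ k := Series (fun i => Series (fun j => f j i)).

Lemma swapK : involutive swap. Proof. by move=> f; apply: germP. Qed.
Lemma swapE f i j : swap f i j = f j i. Proof. by []. Qed.

Lemma germME f g i j : (f * g) i j =
  \sum_(p < i.+1) \sum_(q < j.+1) f p q * g (i - p)%N (j - q)%N.
Proof. by rewrite scoefM scoef_sum; apply: eq_bigr => p _; rewrite scoefM. Qed.

Lemma germ1E i j : (1 : germ k) i j = ((i == 0) && (j == 0))%N%:R.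
Proof. by case: i j => [|i] [|j]. Qed.

Lemma guE i j : gu k i j = ((i == 1) && (j == 0))%N%:R.
Proof. by case: i j => [|[|i]] [|j]. Qed.

Lemma gvE i j : gv k i j = ((i == 0) && (j == 1))%N%:R.
Proof. by case: i j => [|i] [|[|j]]. Qed.

Fact swap_is_additive : zmod_morphism swap.
Proof. by move=> f g; apply: germP. Qed.
Fact swap_is_multiplicative : monoid_morphism swap.
Proof.
split=> [|f g]; apply: germP => i j; first by rewrite swapE !germ1E andbC.
by rewrite swapE !germME exchange_big.
Qed.
HB.instance Definition _ :=
  GRing.isZmodMorphism.Build (germ k) (germ k) swap swap_is_additive.
HB.instance Definition _ :=
  GRing.isMonoidMorphism.Build (germ k) (germ k) swap swap_is_multiplicative.

Lemma swapM f g : swap (f * g) = swap f * swap g.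
Proof. exact: (rmorphM swap). Qed.

Lemma swap_gu : swap (gu k) = gv k.
Proof. by apply: germP => -[|i] [|[|j]]. Qed.
Lemma swap_gv : swap (gv k) = gu k.
Proof. by rewrite -swap_gu swapK. Qed.

(** This is f(u v, v), the pull-back at the point [None]; the pull-back at
    [Some 0] is its conjugate under [swap], so both are ring morphisms for the
    same reason. *)
Definition dilate f : germ k := Series (fun i => svar k ^+ i * f i).

Lemma dilateE f i : dilate f i = svar k ^+ i * f i. Proof. by []. Qed.

Fact dilate_is_additive : zmod_morphism dilate.
Proof. by move=> f g; apply: seriesP => i /=; rewrite -mulrBr. Qed.
Fact dilate_is_multiplicative : monoid_morphism dilate.
Proof.
split=> [|f g]; apply: seriesP => i; rewrite !dilateE.
  by rewrite scoef1; case: i => [|i]; rewrite ?mulr1 // mulr0.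
rewrite !scoefM mulr_sumr; apply: eq_bigr => p _.
by rewrite !dilateE mulrACA -exprD subnKC // -ltnS.
Qed.
HB.instance Definition _ :=
  GRing.isZmodMorphism.Build (germ k) (germ k) dilate dilate_is_additive.
HB.instance Definition _ :=
  GRing.isMonoidMorphism.Build (germ k) (germ k) dilate dilate_is_multiplicative.

Lemma total1_None f : total1 f None = dilate f.
Proof.
apply: germP => i j; rewrite dilateE svarXM ltnNge /=.
by case: leqP.
Qed.

Lemma total1_Some0E f i j :
  total1 f (Some 0) i j = if (j <= i)%N then f (i - j)%N j else 0.
Proof.
rewrite /=; case: leqP => [ji|ij].
  have lt : (j < i.+1)%N by [].
  rewrite (bigD1 (Ordinal lt)) //= subnn mulr1 binn big1 ?addr0 // => b ne.
  have [bj|jb] := ltnP b j; first by rewrite bin_small.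
  rewrite expr0n subn_eq0 leqNgt ltn_neqAle jb eq_sym.
  by rewrite (inj_eq val_inj _ (Ordinal lt)) ne /= mulr0 mul0rn.
by rewrite big1 // => b _; rewrite bin_small //; apply: leq_trans (ltn_ord b) ij.
Qed.

Lemma total1_Some0 f : total1 f (Some 0) = swap (dilate (swap f)).
Proof.
apply: germP => i j; rewrite total1_Some0E swapE dilateE svarXM ltnNge swapE.
by case: leqP.
Qed.

Lemma total1_swap f : swap (total1 f None) = total1 (swap f) (Some 0).
Proof. by rewrite total1_Some0 swapK total1_None. Qed.

Definition pser p : series k := Series (fun n => p`_n).

Fact pser_is_additive : zmod_morphism pser.
Proof. by move=> p q; apply: seriesP => i /=; rewrite coefB. Qed.
Fact pser_is_multiplicative : monoid_morphism pser.
Proof.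
split=> [|p q]; apply: seriesP => i; rewrite ?scoef1 /= ?coef1 //.
by rewrite coefM.
Qed.
HB.instance Definition _ :=
  GRing.isZmodMorphism.Build {poly k} (series k) pser pser_is_additive.
HB.instance Definition _ :=
  GRing.isMonoidMorphism.Build {poly k} (series k) pser pser_is_multiplicative.

Lemma pser_inj : injective pser.
Proof. by move=> p q e; apply/polyP => i; move/(congr1 (fun s : series k => s i)): e. Qed.

(** The homogeneous part of degree [i] of [f], dehomogenized by u = 1. *)
Definition hform f i : {poly k} := \poly_(j < i.+1) f (i - j)%N j.

Lemma coef_hform f i j : (hform f i)`_j = if (j <= i)%N then f (i - j)%N j else 0.
Proof. by rewrite coef_poly ltnS. Qed.

Lemma total1_Some0_hform f i : total1 f (Some 0) i = pser (hform f i).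
Proof. by apply: seriesP => j; rewrite total1_Some0E /= coef_hform. Qed.

(** The forms are the coefficients of the powers of [u] in f(u, u v), so their
    product rule is the multiplicativity of that pull-back. *)
Lemma hformM f g n : hform (f * g) n = \sum_(i < n.+1) hform f i * hform g (n - i).
Proof.
have T0M : total1 (f * g) (Some 0) = total1 f (Some 0) * total1 g (Some 0).
  by rewrite !total1_Some0 !rmorphM.
apply: pser_inj; rewrite -total1_Some0_hform T0M.
rewrite scoefM rmorph_sum; apply: eq_bigr => i _.
by rewrite !total1_Some0_hform rmorphM.
Qed.

Lemma hformB f g n : hform (f - g) n = hform f n - hform g n.
Proof.
apply/polyP => j; rewrite coefB !coef_hform.
by case: ifP => // _; rewrite subr0.
Qed.

Lemma coef_XDaX a n j : (('X + a%:P) ^+ n)`_j = a ^+ (n - j) *+ 'C(n, j).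
Proof.
rewrite addrC exprDn coef_sum.
have [lt|ge] := ltnP j n.+1; last first.
  rewrite bin_small // big1 // => i _.
  rewrite coefMn -rmorphXn coefCM coefXn gtn_eqF ?mulr0 ?mul0rn //.
  exact: leq_trans (ltn_ord i) ge.
rewrite (bigD1 (Ordinal lt)) //= big1 ?addr0 => [|i ne].
  by rewrite coefMn -rmorphXn coefCM coefXn eqxx mulr1.
rewrite coefMn -rmorphXn coefCM coefXn (_ : _ == _ = false) ?mulr0 ?mul0rn //.
by apply: contraNF ne => /eqP e; apply/eqP/val_inj.
Qed.

(** The form of degree [i] pulls back to [u ^ i] times itself at u = 1,
    translated to the chosen point of the exceptional line. *)
Lemma total1_Some_hform f a i :
  total1 f (Some a) i = pser (hform f i \Po ('X + a%:P)).
Proof.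
apply: seriesP => j /=; rewrite /hform poly_def raddf_sum /= coef_sum.
apply: eq_bigr => b _.
by rewrite comp_polyZ coefZ comp_Xn_poly coef_XDaX mulrnAr.
Qed.

Fact total1_is_additive c : zmod_morphism (fun f => total1 f c).
Proof.
case: c => [a|] f g; last by rewrite !total1_None rmorphB.
apply: seriesP => i; rewrite scoefB !total1_Some_hform.
by rewrite hformB !rmorphB.
Qed.
Fact total1_is_multiplicative c : monoid_morphism (fun f => total1 f c).
Proof.
case: c => [a|]; last by split=> [|f g]; rewrite !total1_None ?rmorph1 ?rmorphM.
split=> [|f g]; apply: seriesP => i.
  rewrite total1_Some_hform (_ : hform 1 i = (i == 0%N)%:R) ?rmorph_nat ?scoef1 //.
  apply/polyP => j; rewrite coef_hform germ1E.
  case: i => [|i]; rewrite ?coef1 ?coef0; first by case: j.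
  by case: j => [|j] //=; rewrite ?andbF ?if_same.
rewrite total1_Some_hform hformM scoefM !rmorph_sum; apply: eq_bigr => p _.
by rewrite !total1_Some_hform !rmorphM.
Qed.

(** [total1] with its arguments in the order that lets the pull-back at a fixed
    point be declared a ring morphism. *)
Definition blowup c f := total1 f c.
HB.instance Definition _ c := GRing.isZmodMorphism.Build (germ k) (germ k)
  (blowup c) (total1_is_additive c).
HB.instance Definition _ c := GRing.isMonoidMorphism.Build (germ k) (germ k)
  (blowup c) (total1_is_multiplicative c).

End Germs.

(** * Multiplicities and strict transforms *)

Section Mult.
Variable k : fieldType.
Implicit Types (f g h : germ k) (a : k) (b : bool) (c q : option k) (p : {poly k}).
Implicit Types (pts : seq (option k)).

Lemma comp_XDC_eq0 p a : (p \Po ('X + a%:P) == 0) = (p == 0).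
Proof.
by rewrite comp_poly2_eq0 // size_XaddC.
Qed.

(** A relational form of [multiplicity], which rules out the zero germ. *)
Definition hasmult f m := (forall i, (i < m)%N -> hform f i = 0) /\ hform f m != 0.

Lemma total1_Some_eq0 f a i : (total1 f (Some a) i == 0) = (hform f i == 0).
Proof.
rewrite total1_Some_hform -(comp_XDC_eq0 _ a); apply/eqP/eqP => [|->].
  by rewrite -(rmorph0 (@pser k)) => /pser_inj.
by rewrite rmorph0.
Qed.

Lemma hasmult_order f a m : hasmult f m <-> hasorder (total1 f (Some a)) m.
Proof.
rewrite /hasmult /hasorder total1_Some_eq0.
split=> -[f0 fm]; split=> // i /f0 /eqP; rewrite ?total1_Some_eq0 => /eqP //.
by move=> e; apply/eqP; rewrite total1_Some_eq0 e.
Qed.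

Lemma hasmult_coef f m : hasmult f m -> forall i j, (i + j < m)%N -> f i j = 0.
Proof.
move=> [f0 _] i j /f0 e; have := congr1 (fun p : {poly k} => p`_j) e.
by rewrite coef_hform leq_addl addnK coef0.
Qed.

Lemma hform_neq0 f n : (hform f n != 0) = [exists i : 'I_n.+1, f i (n - i)%N != 0].
Proof.
apply/idP/idP => [|/existsP[i fi]].
  apply: contraR => /existsPn f0; apply/eqP/polyP => j; rewrite coef_hform coef0.
  case: leqP => // jn.
  have lt : (n - j < n.+1)%N by lia.
  by have := f0 (Ordinal lt); rewrite negbK /= subKn // => /eqP.
apply: contra fi => /eqP /(congr1 (fun p : {poly k} => p`_(n - i))).
by rewrite coef_hform coef0 leq_subr subKn -1?ltnS // => ->.
Qed.

Lemma multiplicity_eq f m : hasmult f m -> multiplicity f = m.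
Proof.
move=> [f0 fm]; apply: least_eq => [|n]; rewrite -hform_neq0 //.
by apply: contraR; rewrite -ltnNge => /f0 ->.
Qed.

Lemma germ_neq0 f : f != 0 -> exists i j, f i j != 0.
Proof.
move=> fn0; apply: contrapT => /forallNP H; case/eqP: fn0; apply: germP => i j.
rewrite !scoef0; apply/eqP/negP => /negP fij.
by have /forallNP /(_ j) := H i.
Qed.

Lemma hasmult_multiplicity f : f != 0 -> hasmult f (multiplicity f).
Proof.
move=> /germ_neq0 [i [j fij]].
pose P n := [exists i : 'I_n.+1, f i (n - i)%N != 0].
have exP : exists n, P n.
  exists (i + j)%N; apply/existsP; have lt : (i < (i + j).+1)%N by lia.
  by exists (Ordinal lt); rewrite /= addKn.
have [Pl minP] := leastP exP; rewrite /multiplicity -/P; split; last by rewrite hform_neq0.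
move=> n; rewrite ltnNge => nl; apply/eqP; apply: contraNT nl.
by rewrite hform_neq0 => /minP.
Qed.

Lemma hasmultM f g m n : hasmult f m -> hasmult g n -> hasmult (f * g) (m + n).
Proof.
move=> /(hasmult_order _ 0) fm /(hasmult_order _ 0) gn; apply/(hasmult_order _ 0).
rewrite [X in hasorder X](rmorphM (blowup (Some 0)) f g).
exact: hasorderM.
Qed.

Lemma multiplicityM f g : f != 0 -> g != 0 ->
  multiplicity (f * g) = (multiplicity f + multiplicity g)%N.
Proof.
by move=> /hasmult_multiplicity fm /hasmult_multiplicity gn; apply/multiplicity_eq/hasmultM.
Qed.

Lemma hasmult_swap f m : hasmult f m -> hasmult (swap f) m.
Proof.
have sw g n : hform g n = 0 -> hform (swap g) n = 0.
  move=> e; apply/polyP => j; have := congr1 (fun p : {poly k} => p`_(n - j)) e.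
  rewrite /= !coef_hform !coef0 leq_subr; have [jn|//] := leqP j n.
  by rewrite subKn.
move=> [f0 fm]; split=> [i /f0 /sw //|]; apply: contra fm => /eqP /sw.
by rewrite swapK => ->.
Qed.

(** The coordinate axes are indexed so that [axis (isSome c)] is the exceptional
    line in the coordinates at the point [c]. *)
Definition axis b : germ k := if b then gu k else gv k.

Lemma exceptionalE c : exceptional c = axis (isSome c).
Proof. by case: c. Qed.

Lemma swap_axis b : swap (axis b) = axis (~~ b).
Proof. by case: b; rewrite /axis /= ?swap_gu ?swap_gv. Qed.

(** The restriction of [f] to [axis b]; its order is the intersection
    multiplicity of [f] and that axis. *)
Definition restr b f : series k := (if b then f else swap f) 0%N.

Fact restr_is_additive b : zmod_morphism (restr b).
Proof. by case: b => f g; apply: seriesP. Qed.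
Fact restr_is_multiplicative b : monoid_morphism (restr b).
Proof.
case: b; split=> [|f g]; rewrite /restr ?scoefM0 //.
  by rewrite (rmorph1 (@swap k)).
by rewrite (rmorphM (@swap k)) scoefM0.
Qed.
HB.instance Definition _ b := GRing.isZmodMorphism.Build (germ k) (series k)
  (restr b) (restr_is_additive b).
HB.instance Definition _ b := GRing.isMonoidMorphism.Build (germ k) (series k)
  (restr b) (restr_is_multiplicative b).

Lemma restr_swap b f : restr b (swap f) = restr (~~ b) f.
Proof. by case: b; rewrite /restr ?swapK. Qed.

Lemma restr_axis b b' : restr b (axis b') = if b == b' then 0 else svar k.
Proof.
by case: b b' => [] []; apply: seriesP => -[|[|n]].
Qed.

Lemma restr0 b f : restr b f 0%N = f 0%N 0%N.
Proof. by case: b. Qed.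

Lemma axis_neq0 b : axis b != 0.
Proof.
apply/eqP => /(congr1 (restr (~~ b))); rewrite restr_axis rmorph0.
by case: b => /= /(congr1 (fun s : series k => s 1%N)) /eqP; rewrite /= oner_eq0.
Qed.

Lemma gvXM r f i : (gv k ^+ r * f) i = svar k ^+ r * f i.
Proof.
elim: r f => [|r IH] f; first by rewrite !expr0 !mul1r.
by rewrite !exprSr -!mulrA IH; congr (_ * _); rewrite sconstM.
Qed.

Lemma axis_XM b r f : axis b ^+ r * f =
  if b then Series (fun i => if (i < r)%N then 0 else f (i - r)%N)
  else Series (fun i => Series (fun j => if (j < r)%N then 0 else f i (j - r)%N)).
Proof.
case: b; first by apply: seriesP => i; rewrite svarXM.
by apply: germP => i j; rewrite gvXM svarXM.
Qed.

(** The exponent in the definition of [strict1] is exact: the total transform is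
    divisible by that power of the exceptional line and by no higher one. *)
Lemma total1_strict f c m : hasmult f m ->
  total1 f c = axis (isSome c) ^+ m * strict1 f c /\
  restr (isSome c) (strict1 f c) != 0.
Proof.
move=> fm; rewrite /strict1 (multiplicity_eq fm).
case: c => [a|]; rewrite axis_XM; split.
- have [f0 _] := (hasmult_order f a m).1 fm.
  apply: germP => i j /=; case: ltnP => [/f0 e|mi]; last by rewrite subnK.
  exact: (congr1 (fun s : series k => s j) e).
- have [_ fn] := (hasmult_order f a m).1 fm.
  by apply: contra fn => /eqP e; apply/eqP; rewrite -e.
- apply: germP => i j; have fc := hasmult_coef fm.
  rewrite [LHS]/=; case: leqP => ij /=; case: ltnP => jm; rewrite ?subnK //.
  + by rewrite fc // subnKC.
  + by rewrite ij.
  + by rewrite [(i <= j)%N]leqNgt ij.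
- case: fm => _; rewrite hform_neq0 => /existsP[i fi].
  apply/eqP => /(congr1 (fun s : series k => s i)) /=.
  by rewrite add0n -ltnS ltn_ord => e; case/eqP: fi; rewrite e if_same.
Qed.

Lemma strict1_neq0 f c : f != 0 -> strict1 f c != 0.
Proof.
move=> /hasmult_multiplicity /(total1_strict c) [_]; apply: contra => /eqP ->.
by rewrite rmorph0.
Qed.

Lemma total1_neq0 f c : f != 0 -> total1 f c != 0.
Proof.
move=> f0; have [-> _] := total1_strict c (hasmult_multiplicity f0).
by rewrite mulf_neq0 ?expf_neq0 ?axis_neq0 ?strict1_neq0.
Qed.

Lemma total1M f g c : total1 (f * g) c = total1 f c * total1 g c.
Proof. exact: (rmorphM (blowup c)). Qed.

Lemma total1_00 f c : total1 f c 0%N 0%N = f 0%N 0%N.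
Proof. by case: c => [a|] //=; rewrite big_ord1 subnn bin0 mulr1. Qed.

(** A factorization of the total transform whose cofactor does not contain the
    exceptional line can only be the one that defines the strict transform. *)
Lemma strict1_uniq f c r g : f != 0 -> total1 f c = axis (isSome c) ^+ r * g ->
  restr (isSome c) g != 0 -> multiplicity f = r /\ strict1 f c = g.
Proof.
move=> f0 e g0; have [e' s0] := total1_strict c (hasmult_multiplicity f0).
have ax0 : restr (isSome c) (axis (isSome c)) = 0 by rewrite restr_axis eqxx.
set m := multiplicity f in e' *; set A := axis _ in e e' ax0.
have A0 : A != 0 := axis_neq0 _.
move: e; rewrite e'.
have cancel_axis x y (F G : germ k) : A ^+ x * F = A ^+ y * G ->
    restr (isSome c) F != 0 -> (x <= y)%N -> x = y /\ F = G.
  move=> eFG F0; rewrite leq_eqVlt => /orP[/eqP xy|xy].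
    by split=> //; move: eFG; rewrite xy => /mulfI; apply; rewrite expf_neq0.
  move: eFG; rewrite -(subnKC (ltnW xy)) exprD -mulrA => /mulfI eF.
  case/eqP: F0; rewrite eF ?expf_neq0 // rmorphM rmorphXn /= ax0.
  by rewrite expr0n subn_eq0 leqNgt xy mul0r.
move=> e; have [mr|rm] := leqP m r.
  by have [] := cancel_axis _ _ _ _ e s0 mr.
by have [] := cancel_axis _ _ _ _ (esym e) g0 (ltnW rm).
Qed.

(** The strict transform of [axis b] passes through the point [c], where it is
    again a coordinate axis; otherwise it misses [c]. *)
Definition persists b c := if c is Some a then ~~ b && (a == 0) else b.

Lemma total1_gu a : total1 (gu k) (Some a) = gu k.
Proof.
apply: seriesP => i; rewrite total1_Some_hform.
have -> : hform (gu k) i = if i == 1%N then 1 else 0.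
  apply/polyP => j; rewrite coef_hform guE.
  case: (eqVneq i 1%N) => [->|i1]; rewrite ?coef1 ?coef0; first by case: j => [|[|j]].
  case: leqP => // ji; case: j ji => [|j] _; rewrite ?subn0 ?andbF //.
  by rewrite (negPf i1).
by case: i => [|[|i]]; rewrite ?comp_poly0 ?comp_polyC ?rmorph1 ?rmorph0.
Qed.

Lemma total1_gv a : total1 (gv k) (Some a) = gu k * (gv k + gconst a).
Proof.
apply: seriesP => i; rewrite svarM total1_Some_hform.
have -> : hform (gv k) i = if i == 1%N then 'X else 0.
  apply/polyP => j; rewrite coef_hform gvE.
  case: (eqVneq i 1%N) => [->|i1]; rewrite ?coefX ?coef0; first by case: j => [|[|j]].
  case: leqP => // ji; case: eqP => //= /eqP; rewrite subn_eq0 => ij.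
  by rewrite (@anti_leq j i) ?(negPf i1) // ji ij.
case: i => [|[|i]]; rewrite [_ == _]/= ?comp_poly0 ?comp_polyX ?rmorph0 //.
  apply: seriesP => j; rewrite [LHS]/= coefD coefX coefC.
  by case: j => [|[|j]].
by apply: seriesP => j; rewrite !scoefD /= if_same addr0.
Qed.

Lemma total1_axis b c :
  (persists b c /\ total1 (axis b) c = axis (isSome c) * axis b) \/
  (~~ persists b c /\
   exists2 w : germ k, w 0%N 0%N != 0 & total1 (axis b) c = axis (isSome c) * w).
Proof.
rewrite /axis /isSome /persists; case: c => [a|]; case: b.
- right; split=> //; exists 1; first by rewrite germ1E oner_neq0.
  by rewrite total1_gu mulr1.
- have [a0|a0] := eqVneq a 0; [left|right]; split=> //.
    by rewrite total1_gv a0; congr (_ * _); apply: germP => -[|i] [|[|j]] /=; rewrite ?addr0.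
  exists (gv k + gconst a); last exact: total1_gv.
  by rewrite scoefD /= add0r.
- left; split=> //; rewrite -[gv k]expr1; apply: seriesP => i.
  rewrite gvXM total1_None dilateE.
  by case: i => [|[|i]]; rewrite ?expr1 // !mulr0.
- right; split=> //; exists 1; first by rewrite germ1E oner_neq0.
  rewrite mulr1 total1_None; apply: seriesP => i; rewrite dilateE.
  by case: i => [|i]; rewrite ?expr0 ?mul1r // mulr0.
Qed.

(** Near its strict transform, an axis that persists is mapped isomorphically by
    the blowing-up. *)
Lemma restr_total1 b c f : persists b c -> restr b (total1 f c) = restr b f.
Proof.
case: c b => [a|] [] //= => [/eqP -> |_]; apply: seriesP => i.
  by rewrite /restr !swapE total1_Some0E subn0.
by rewrite /restr /= subn0.
Qed.

End Mult.

Arguments total1 : simpl never.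

(** * Weierstrass division and the descent of germs *)

(** Sequences defined by course-of-values recursion: each term may depend on all
    the previous ones. *)
Lemma strong_rec_ex (T : Type) (x0 : T) (step : nat -> (nat -> T) -> T) :
  (forall n f g, (forall i, (i < n)%N -> f i = g i) -> step n f = step n g) ->
  exists f, forall n, f n = step n f.
Proof.
move=> ext; pose pre n := iteri n (fun m s => rcons s (step m (nth x0 s))) [::].
have sz n : size (pre n) = n by elim: n => //= n IH; rewrite size_rcons IH.
have prenth n i : (i < n)%N -> nth x0 (pre n) i = nth x0 (pre i.+1) i.
  elim: n => // n IH; rewrite ltnS leq_eqVlt => /orP[/eqP -> //|lt].
  by rewrite /pre iteriS -/(pre n) nth_rcons sz lt IH.
exists (fun n => nth x0 (pre n.+1) n) => n.
rewrite {1}/pre iteriS -/(pre n) nth_rcons sz ltnn eqxx.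
by apply: ext => i lt; rewrite prenth.
Qed.

Section Weierstrass.
Variable k : fieldType.
Implicit Types (f g h F G R X phi psi w A B : germ k) (s t : series k) (a : k).

Lemma series_inverse s : s 0%N != 0 -> exists t, t * s = 1.
Proof.
move=> s0.
have [|t Ht] := @strong_rec_ex k 0
    (fun n x => ((n == 0)%N%:R - \sum_(i < n) x i * s (n - i)%N) / s 0%N).
  move=> n f g e; congr ((_ - _) / _); apply: eq_bigr => i _.
  by rewrite e.
exists (Series t); apply: seriesP => n.
rewrite scoefM scoef1 big_ord_recr /= subnn [t n]Ht divfK // addrC subrK //.
Qed.

(** Up to a unit, a series of order [r] is the [r]-th power of the variable. *)
Lemma hasorder_inverse s r : hasorder s r -> exists t, t * s = svar k ^+ r.
Proof.
move=> [s0 sr]; pose U := Series (fun j => s (j + r)%N) : series k.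
have sU : s = svar k ^+ r * U.
  apply: seriesP => j; rewrite svarXM; case: ltnP => [/s0 //|rj].
  by rewrite /= subnK.
have [|V VU] := @series_inverse U; first by [].
by exists V; rewrite sU mulrCA VU mulr1.
Qed.

Lemma shift_series s r : (forall j, (j < r)%N -> s j = 0) ->
  svar k ^+ r * Series (fun j => s (j + r)%N) = s.
Proof.
move=> s0; apply: seriesP => j; rewrite svarXM.
by case: ltnP => [/s0 //|rj]; rewrite /= subnK.
Qed.

Lemma series_divides s t r : hasorder s r -> (forall j, (j < r)%N -> t j = 0) ->
  exists x, t = x * s.
Proof.
move=> /hasorder_inverse [V Vs] t0; exists (V * Series (fun j => t (j + r)%N)).
by rewrite mulrAC Vs shift_series.
Qed.

(** Weierstrass division.  The coefficient of [u ^ n] in the quotient is found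
    from the previous ones, because [G] restricted to [u = 0] is a unit times
    [v ^ r]; the condition on [R] says that [R] is a polynomial of degree less
    than [r] in [v]. *)
Lemma weierstrass_division G r : hasorder (restr true G) r ->
  forall F, exists Q R, F = Q * G + R /\ forall i j, (r <= j)%N -> R i j = 0.
Proof.
move=> /hasorder_inverse [V VG] F.
pose quot s := V * Series (fun j => s (j + r)%N).
have quotP s j : (r <= j)%N -> (quot s * G 0%N) j = s j.
  by move=> rj; rewrite /quot mulrAC VG svarXM ltnNge rj /= subnK.
have [|Q HQ] := @strong_rec_ex (series k) 0
    (fun n Q => quot (F n - \sum_(l < n) Q l * G (n - l)%N)).
  move=> n f g e; congr (quot (_ - _)); apply: eq_bigr => i _.
  by rewrite e.
exists (Series Q : germ k), (F - (Series Q : germ k) * G).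
split; first by rewrite addrC subrK.
move=> i j rj; set S := \sum_(l < i) Q l * G (i - l)%N.
have e : ((Series Q : germ k) * G) i = S + Q i * G 0%N.
  by rewrite scoefM big_ord_recr /= subnn.
have eQ : (Q i * G 0%N) j = F i j - S j by rewrite [Q i]HQ quotP.
change (F i j - ((Series Q : germ k) * G) i j = 0).
by rewrite e scoefD eQ [S j + _]addrC subrK subrr.
Qed.

(** If [X] has order [n] in [u], the coefficient of [u ^ n] in [X * G] has order
    at least [r] in [v], which a remainder cannot have. *)
Lemma weierstrass_division_uniq G r X : hasorder (restr true G) r ->
  (forall i j, (r <= j)%N -> (X * G) i j = 0) -> X = 0.
Proof.
move=> Gr XG; apply/eqP/negP => /negP /hasorder_ex [n [X0 Xn]].
have [s Xs] := hasorder_ex Xn.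
have [_ /eqP[]] := hasorderM Xs Gr; rewrite -[RHS](XG n (s + r)%N) ?leq_addl //.
congr (scoef _ _); rewrite scoefM big_ord_recr /= subnn big1 ?add0r // => i _.
by rewrite X0 ?mul0r.
Qed.

Lemma svarX_coef r j : (svar k ^+ r) j = (j == r)%:R.
Proof.
rewrite -[svar k ^+ r]mulr1 svarXM scoef1; case: ltngtP => //.
  by move=> lt; rewrite subn_eq0 leqNgt lt.
by move=> ->; rewrite subnn.
Qed.

Lemma restr_gvX r : restr true (gv k ^+ r) = svar k ^+ r.
Proof. by rewrite rmorphXn /= -[gv k]/(axis k false) restr_axis. Qed.

(** Weierstrass preparation: divide [v ^ r] by [G]. *)
Lemma weierstrass_preparation G r : hasorder (restr true G) r ->
  exists w R, [/\ w 0%N 0%N != 0, w * G = gv k ^+ r - R,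
    forall i j, (r <= j)%N -> R i j = 0 & R 0%N = 0].
Proof.
move=> ordG; have [Q [R [eQ R0]]] := weierstrass_division ordG (gv k ^+ r).
have eQ0 := congr1 (restr true) eQ; rewrite restr_gvX rmorphD rmorphM /= in eQ0.
have eQ0j j : (svar k ^+ r) j = (restr true Q * restr true G) j + R 0%N j.
  by rewrite eQ0 scoefD.
have [s Qs] : exists n, hasorder (restr true Q) n.
  apply: hasorder_ex; apply/eqP => Qz; have := eQ0j r.
  rewrite Qz mul0r scoef0 add0r svarX_coef eqxx R0 // => /eqP.
  by rewrite oner_eq0.
have [low _] := hasorderM Qs ordG.
(* The coefficient of v ^ r forces the quotient to be a unit on u = 0. *)
have s0 : s = 0%N.
  apply/eqP; rewrite -leqn0 leqNgt; apply/negP => spos; have := eQ0j r.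
  rewrite low; last by rewrite -[X in (X < _)%N]add0n ltn_add2r.
  by rewrite svarX_coef eqxx add0r R0 // => /eqP; rewrite oner_eq0.
rewrite s0 in Qs low; exists Q, R; split=> //.
- by case: Qs => _; rewrite restr0.
- by rewrite eQ addrK.
- apply: seriesP => j; rewrite scoef0.
  have [jr|rj] := ltnP j r; last by rewrite R0.
  by have := eQ0j j; rewrite low ?add0n // svarX_coef (ltn_eqF jr) add0r.
Qed.

Definition series_of_u s : germ k := Series (fun i => sconst (s i)).

Lemma total1_series_of_u s a : total1 (series_of_u s) (Some a) = series_of_u s.
Proof.
apply: seriesP => i; rewrite total1_Some_hform.
have -> : hform (series_of_u s) i = (s i)%:P.
  apply/polyP => j; rewrite coef_hform coefC; case: j => [|j] /=; rewrite ?subn0 //.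
  by rewrite if_same.
by rewrite comp_polyC; apply: seriesP => j /=; rewrite coefC.
Qed.

Lemma gconst_series_of_u a : gconst a = series_of_u (sconst a).
Proof. by apply: germP => -[|i] [|j]. Qed.

Lemma low_degree_sum R r : (forall i j, (r <= j)%N -> R i j = 0) ->
  R = \sum_(l < r) series_of_u (Series (fun i => R i l)) * gv k ^+ l.
Proof.
move=> R0; apply: germP => i j; rewrite !scoef_sum.
have E (l : nat) : (series_of_u (Series (fun i => R i l)) * gv k ^+ l) i j =
    if j == l then R i l else 0.
  rewrite mulrC gvXM svarXM /=; case: ltngtP => //.
    by move=> lt; rewrite subn_eq0 leqNgt lt.
  by move=> ->; rewrite subnn.
under eq_bigr do rewrite E.
have [rj|jr] := leqP r j.
  rewrite R0 // big1 // => l _; case: eqP => // e; have := ltn_ord l; lia.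
rewrite (bigD1 (Ordinal jr)) //= eqxx big1 ?addr0 // => l ne.
by case: eqP => // e; case/eqP: ne; apply: val_inj.
Qed.

Lemma total1_low_degree R r a : (forall i j, (r <= j)%N -> R i j = 0) ->
  forall i j, (r <= j)%N -> total1 R (Some a) i j = 0.
Proof.
move=> R0 i j rj; rewrite /total1 /= big1 // => b _.
have [bj|jb] := ltnP b j; first by rewrite bin_small.
by rewrite R0 ?mul0r ?mul0rn //; exact: leq_trans rj jb.
Qed.

(** A germ [psi'] at the point [a] of the exceptional line, meeting that line
    with multiplicity [r], is up to a unit the strict transform of a germ [psi]
    of multiplicity [r] whose only tangent is the direction [a]: prepare [psi']
    as a polynomial of degree [r] in [v'] and clear denominators.  If [psi']
    divides the strict transform of [phi], then [psi] divides [phi]: the total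
    transform of the remainder of [phi] modulo [psi] is a multiple of [psi'] of
    degree less than [r] in [v'], hence zero.  The last conclusion says that an
    axis transverse to the tangent meets [psi] with multiplicity [r]. *)
Lemma blow_down_Some phi psi' B a r : phi != 0 ->
  strict1 phi (Some a) = B * psi' -> hasorder (restr true psi') r ->
  exists psi w, [/\ w 0%N 0%N != 0, total1 psi (Some a) = gu k ^+ r * (w * psi'),
    exists A, phi = A * psi, hasmult psi r
    & forall b, ~~ persists b (Some a) -> hasorder (restr b psi) r].
Proof.
move=> phi0 ephi ord'.
have [Q [R [Q00 eQ R0 Rz]]] := weierstrass_preparation ord'.
(* In the coordinates u, y one has u = u', y = u' v', so a polynomial in v' of
   degree r times u' ^ r is the total transform of a polynomial in y. *)
pose y := gv k - gconst a * gu k.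
have ty : total1 y (Some a) = gu k * gv k.
  rewrite [LHS](rmorphB (blowup (Some a))) (rmorphM (blowup (Some a))) /= /blowup.
  by rewrite total1_gu total1_gv gconst_series_of_u total1_series_of_u; ring.
pose psi := y ^+ r -
  \sum_(l < r) series_of_u (Series (fun i => R i l)) * gu k ^+ (r - l) * y ^+ l.
have tpsi : total1 psi (Some a) = gu k ^+ r * (Q * psi').
  rewrite eQ [LHS](rmorphB (blowup (Some a))) rmorphXn rmorph_sum /= /blowup ty exprMn mulrBr.
  congr (_ - _); rewrite {2}(low_degree_sum R0) mulr_sumr; apply: eq_bigr => l _.
  rewrite !total1M total1_series_of_u [X in _ * X * _](rmorphXn (blowup (Some a))).
  rewrite [X in _ * _ * X](rmorphXn (blowup (Some a))) /= /blowup total1_gu ty exprMn.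
  have -> : gu k ^+ r = gu k ^+ (r - l) * gu k ^+ l.
    by rewrite -exprD subnK // ltnW.
  ring.
have P0 : (Q * psi') 0%N = pser 'X^r.
  rewrite eQ scoefD scoefN Rz subr0 [LHS]restr_gvX; apply: seriesP => j.
  by rewrite svarX_coef /= coefXn.
have hf i : (i < r)%N -> hform psi i \Po ('X + a%:P) = 0.
  move=> ir; apply: pser_inj.
  by rewrite -total1_Some_hform tpsi svarXM ir rmorph0.
have hfr : hform psi r \Po ('X + a%:P) = 'X^r.
  apply: pser_inj.
  by rewrite -total1_Some_hform tpsi svarXM ltnn subnn P0.
have hr : hform psi r = ('X - a%:P) ^+ r.
  have := congr1 (fun p => p \Po ('X - a%:P)) hfr.
  rewrite -comp_polyA comp_polyD comp_polyX comp_polyC subrK.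
  by rewrite comp_polyXr comp_Xn_poly.
have mpsi : hasmult psi r.
  split=> [i ir|]; last by rewrite hr expf_neq0 // polyXsubC_eq0.
  by have := hf i ir => /eqP; rewrite comp_XDC_eq0 => /eqP.
have coefpsi i j : (i + j < r)%N -> psi i j = 0 by apply: hasmult_coef.
have ord_t : hasorder (restr true psi) r.
  split=> [j jr|]; first by apply: coefpsi.
  have := coef_hform psi r r; rewrite hr leqnn subnn /restr => <-.
  have /monicP := monic_exp r (monicXsubC a).
  by rewrite /lead_coef size_exp_XsubC => ->; rewrite oner_neq0.
exists psi, Q; split=> //.
  have [A [S [eS S0]]] := weierstrass_division ord_t phi; exists A.
  suff: S = 0 by move=> Sz; rewrite [LHS]eS Sz addr0.
  apply/eqP/negP => /negP /(total1_neq0 (Some a)) /eqP; apply.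
  have [e1 _] := total1_strict (Some a) (hasmult_multiplicity phi0).
  rewrite ephi [axis _]/= in e1.
  have e2 : total1 S (Some a) =
     (gu k ^+ multiplicity phi * B - total1 A (Some a) * gu k ^+ r * Q) * psi'.
    have -> : S = phi - A * psi by rewrite [phi in RHS]eS addrC addKr.
    rewrite [LHS](rmorphB (blowup (Some a))) (rmorphM (blowup (Some a))) /= /blowup.
    by rewrite e1 tpsi; ring.
  have z : gu k ^+ multiplicity phi * B - total1 A (Some a) * gu k ^+ r * Q = 0.
    apply: (weierstrass_division_uniq ord') => i j rj; rewrite -e2.
    exact: total1_low_degree S0 _ _ _.
  by rewrite e2 z mul0r.
move=> [_|]; first exact: ord_t.
move=> /= a0; split=> [j jr|]; first by apply: coefpsi; rewrite addn0.
have := coef_hform psi r 0; rewrite hr subn0 /= => <-.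
by rewrite -horner_coef0 horner_exp hornerXsubC sub0r expf_neq0 // oppr_eq0.
Qed.

Lemma strict1_swap f : f != 0 -> strict1 (swap f) (Some 0) = swap (strict1 f None).
Proof.
move=> f0; have m := multiplicity_eq (hasmult_swap (hasmult_multiplicity f0)).
rewrite /strict1 m; apply: germP => i j.
by rewrite -total1_swap.
Qed.

Lemma blow_down phi psi' B c r : phi != 0 ->
  strict1 phi c = B * psi' -> hasorder (restr (isSome c) psi') r ->
  exists psi w, [/\ w 0%N 0%N != 0, total1 psi c = axis k (isSome c) ^+ r * (w * psi'),
    exists A, phi = A * psi, hasmult psi r
    & forall b, ~~ persists b c -> hasorder (restr b psi) r].
Proof.
case: c => [a|] phi0 e ord; first exact: blow_down_Some e ord.
have sphi0 : swap phi != 0 by apply: contra phi0 => /eqP e0; rewrite -(swapK phi) e0 rmorph0.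
have e' : strict1 (swap phi) (Some 0) = swap B * swap psi'.
  by rewrite strict1_swap // e rmorphM.
have ord' : hasorder (restr true (swap psi')) r by rewrite restr_swap.
have [psi [w [w0 tp [A eA] mp hp]]] := blow_down_Some sphi0 e' ord'.
exists (swap psi), (swap w); split=> //.
- rewrite -[LHS]swapK total1_swap swapK tp !rmorphM rmorphXn /= swapK.
  by rewrite (swap_axis k true).
- by exists (swap A); rewrite -(swapK phi) eA rmorphM.
- exact: hasmult_swap.
- by move=> [] // _; rewrite restr_swap; apply: hp.
Qed.

End Weierstrass.

(** * Intersection multiplicity with an axis *)

Arguments swap : simpl never.

Section Intersection.
Variable k : fieldType.
Implicit Types (f g h F G R X phi psi w A B : germ k) (s t : series k) (b : bool).

Definition lift_axis b s : germ k := if b then sconst s else swap (sconst s).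

Lemma restr_lift b s : restr b (lift_axis b s) = s.
Proof. by case: b; apply: seriesP. Qed.

Lemma restr_eq0 b F : restr b F = 0 -> exists G, F = axis k b * G.
Proof.
have T (H : germ k) : restr true H = 0 -> exists G, H = axis k true * G.
  move=> H0; exists (Series (fun i => H i.+1)); apply: seriesP => i.
  by rewrite svarM; case: i.
case: b => [|F0]; first exact: T.
have [|G eG] := T (swap F); first by rewrite restr_swap.
exists (swap G); apply: (inv_inj (@swapK k)); rewrite eG.
by rewrite swapM swapK swap_axis.
Qed.

Lemma restr_gconst b a f : restr b (gconst a * f) = sconst a * restr b f.
Proof.
rewrite rmorphM /=; congr (_ * _).
by case: b; apply: seriesP => -[|n].
Qed.

(** The algebra k[[u, v]] / (f, axis) is k[[t]] / (s0) for s0 the restriction of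
    [f].  A spanning family of [d] elements surjects onto k[[t]] / (t ^ r) when
    t ^ r divides s0, so [r <= d]; and if s0 has order [r < d], a linear relation
    modulo t ^ r contradicts the uniqueness of coordinates. *)
Lemma intersection_axis f b d :
  intersection_multiplicity f (axis k b) d -> hasorder (restr b f) d.
Proof.
move=> [e He]; set s0 := restr b f.
pose M (t : nat) := (\matrix_(i < d, j < t) restr b (e i) j) : 'M[k]_(d, t).
have restr_comb (a : {ffun 'I_d -> k}) (t : nat) (j : 'I_t) :
    restr b (\sum_(i < d) gconst (a i) * e i) j = ((\row_i a i) *m M t) 0 j.
  rewrite rmorph_sum /= scoef_sum mxE; apply: eq_bigr => i _.
  by rewrite restr_gconst sconstM !mxE.
have low (t : nat) : (forall j, (j < t)%N -> s0 j = 0) -> (t <= d)%N.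
  move=> s0t; suff: row_full (M t) by move=> /eqP <-; apply: rank_leq_row.
  rewrite -sub1mx; apply/row_subP => l; apply/submxP.
  have [a [[r [s E]] _]] := He (lift_axis b (svar k ^+ l)).
  exists (\row_i a i); apply/rowP => j.
  have := congr1 (restr b) E; rewrite restr_lift !rmorphD !(rmorphM (restr b)) /=.
  rewrite restr_axis eqxx mulr0 addr0 => /(congr1 (fun s : series k => s j)).
  rewrite scoefD restr_comb.
  have -> : (restr b r * restr b f) j = 0.
    rewrite scoefM big1 // => i _; rewrite -/s0 s0t ?mulr0 //.
    by have := ltn_ord j; lia.
  by rewrite addr0 => <-; rewrite !mxE svarX_coef eq_sym (inj_eq val_inj).
have [s00|/hasorder_ex [r s0r]] := eqVneq s0 0.
  have : (d.+1 <= d)%N by apply: low => j _; rewrite s00 scoef0.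
  by rewrite ltnn.
suff dr : d = r by rewrite dr.
apply/eqP; rewrite eqn_leq [X in _ && X]low ?andbT; last by case: s0r.
rewrite leqNgt; apply/negP => rd.
have : kermx (M r) != 0.
  rewrite -mxrank_eq0 mxrank_ker subn_eq0 -ltnNge.
  by apply: leq_ltn_trans rd; apply: rank_leq_col.
case/rowV0Pn => v /sub_kermxP vM v0.
pose a := [ffun i => v 0 i] : {ffun 'I_d -> k}.
pose h := \sum_(i < d) gconst (a i) * e i.
have [|sg esg] := @series_divides k s0 (restr b h) r s0r.
  move=> j jr; have := restr_comb a r (Ordinal jr); rewrite /= => ->.
  have -> : \row_i a i = v by apply/rowP => i; rewrite !mxE ffunE.
  by rewrite vM mxE.
have [|G eG] := @restr_eq0 b (h - lift_axis b sg * f).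
  by rewrite rmorphB rmorphM /= restr_lift esg subrr.
have [a1 [_ U]] := He h.
have ea : a1 = a.
  apply: U; exists 0, 0; by rewrite !mul0r !addr0.
have e0 : a1 = [ffun=> 0].
  apply: U; exists (lift_axis b sg), G.
  rewrite big1 ?add0r => [|i _]; last first.
    by rewrite ffunE (_ : gconst 0 = 0) ?mul0r //; apply: germP => -[|i'] [|j].
  by rewrite [G * _]mulrC -eG addrC subrK.
case/eqP: v0; apply/rowP => i; rewrite mxE.
have : a i = 0 by rewrite -ea e0 ffunE.
by rewrite ffunE.
Qed.

Lemma intersection_multiplicityC f g d :
  intersection_multiplicity f g d -> intersection_multiplicity g f d.
Proof.
move=> [e He]; exists e => h; have [a [[r [s E]] U]] := He h.
exists a; split=> [|a' [r' [s' E']]]; first by exists s, r; rewrite E addrAC.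
by apply: U; exists s', r'; rewrite E' addrAC.
Qed.

End Intersection.

(** * The intersection inequality for curvettes *)

Section Curvettes.
Variable k : fieldType.
Implicit Types (f g h F G R X phi psi w A B : germ k) (b : bool).
Implicit Types (c q : option k) (pts : seq (option k)) (mu : germ k -> nat).
Implicit Types (S : bool -> Prop).
Local Notation axis := (axis k).

(** Multiplicativity is asked of nonzero germs only: [multiplicity] is 0 at the
    zero germ. *)
Definition germ_valuation mu :=
  (forall f g, f != 0 -> g != 0 -> mu (f * g) = (mu f + mu g)%N) /\
  (forall w, w 0%N 0%N != 0 -> mu w = 0%N).

Lemma germ_valuationX mu f r : germ_valuation mu -> f != 0 -> mu (f ^+ r) = (r * mu f)%N.
Proof.
move=> [muM mu1] f0; elim: r => [|r IH]; first by rewrite mu1 // germ1E oner_neq0.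
by rewrite exprS muM ?expf_neq0 // IH.
Qed.

Lemma unit_neq0 w : w 0%N 0%N != 0 -> w != 0.
Proof. by apply: contra => /eqP ->; rewrite !scoef0. Qed.

(** What the induction on blowing-ups carries.  [mu] is the order along the last
    exceptional line, [psi] a germ at the current point, and [S] selects the axes to
    which the conclusions apply: those whose strict transforms avoid the point
    where [psi] meets that line and, at this very point, the line itself. *)
Definition curvette_data mu psi S :=
  [/\ psi 0%N 0%N = 0, psi != 0,
      forall b, S b -> hasorder (restr b psi) (mu (axis b))
    & forall b f r, S b -> f != 0 -> hasorder (restr b f) r ->
        (mu f * mu (axis b) <= r * mu psi)%N].

(** The restriction of the strict transform to the exceptional line is the
    initial form of [f], a polynomial of degree at most [m]. *)
Lemma strict_order_le f c m t : hasmult f m ->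
  hasorder (restr (isSome c) (strict1 f c)) t -> (t <= m)%N.
Proof.
move=> fm [_]; rewrite /strict1 (multiplicity_eq fm); case: c => [a|].
  rewrite /restr /= add0n => nz; rewrite leqNgt; apply: contra nz => mt.
  rewrite big1 // => i _; rewrite bin_small //.
  by apply: leq_ltn_trans mt; rewrite -ltnS.
by rewrite /restr swapE /= add0n; case: leqP; rewrite ?eqxx.
Qed.

Lemma mult_le_order b f m s : hasmult f m -> hasorder (restr b f) s -> (m <= s)%N.
Proof.
move=> fm [_ fs]; rewrite leqNgt; apply: contra fs => sm.
have := hasmult_coef fm; case: b => fc; first by rewrite /restr fc.
by rewrite /restr swapE fc // addn0.
Qed.

(** Multiplied by [N], the difference of the two sides is at least
    (N - r beta) (m N - a r), a product of nonnegative factors; if [N = 0], then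
    [a] and [beta] vanish. *)
Lemma step_inequality (m r a N S beta : nat) : (0 < r)%N ->
  (a * r <= m * N)%N -> (a * beta <= S * N)%N -> (beta * r <= N)%N ->
  ((m * r + a) * (r + beta) <= (m + S) * (r * r + N))%N.
Proof.
move=> r0 h1 h2 h3; have [N0|N0] := posnP N.
  have a0 : a = 0%N by nia.
  have b0 : beta = 0%N by nia.
  by rewrite a0 b0 N0; nia.
suff : (m * r * beta + a * r <= m * N + S * (r * r))%N by nia.
suff : (N * (m * r * beta + a * r) <= N * (m * N + S * (r * r)))%N.
  by rewrite leq_pmul2l.
have h4 : (0 <= (N%:Z - (r * beta)%:Z) * ((m * N)%:Z - (a * r)%:Z)).
  by apply: mulr_ge0; lia.
have h5 : (a * beta * (r * r) <= S * N * (r * r))%N by rewrite leq_mul2r h2 orbT.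
nia.
Qed.

(** For the inequality, write the value of [f] after the blowing-up as
    [m r + mu f'], with [m] its multiplicity and [f'] its strict transform, and
    likewise for the axis and for [psi].  The hypotheses of [step_inequality] are
    instances of the inequality at the new point: for [f'] and the exceptional
    line, whose intersection is at most [m]; for [f'] and the strict transform of
    the axis; and for this strict transform and the exceptional line.  An axis
    that does not persist becomes a unit, of value 0, and meets [f] with
    multiplicity at least [m]. *)
Lemma curvette_step mu c psi psi' w r S S' : germ_valuation mu ->
  curvette_data mu psi' S' -> S' (isSome c) -> r = mu (axis (isSome c)) ->
  w 0%N 0%N != 0 -> total1 psi c = axis (isSome c) ^+ r * (w * psi') ->
  hasmult psi r -> (forall b, ~~ persists b c -> hasorder (restr b psi) r) ->
  (forall b, S b -> persists b c -> S' b) ->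
  curvette_data (fun f => mu (total1 f c)) psi S.
Proof.
move=> muV [psi'00 psi'0 ordpsi' ineq'] SE er w0 tpsi mpsi npers SS'.
have [muM mu1] := muV; set E := isSome c in SE er tpsi.
have E0 : axis E != 0 by apply: axis_neq0.
have w1 : w != 0 := unit_neq0 w0.
have r0 : (0 < r)%N.
  rewrite lt0n er; apply/eqP => z; have [_] := ordpsi' _ SE.
  by rewrite z restr0 psi'00 eqxx.
have psi0 : psi != 0.
  apply/eqP => z; case: mpsi => _; rewrite z; case/eqP.
  by apply/polyP => j; rewrite coef_hform !scoef0 if_same coef0.
have muE m f : f != 0 -> mu (axis E ^+ m * f) = (m * r + mu f)%N.
  by move=> f0; rewrite muM ?expf_neq0 // germ_valuationX // er.
have mupsi : mu (total1 psi c) = (r * r + mu psi')%N.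
  by rewrite tpsi muE ?mulf_neq0 // muM // (mu1 w w0).
have persE b : persists b c -> (b == E) = false.
  by rewrite /E; case: c {tpsi npers SS' mupsi E SE er E0 muE} => [a|]; case: b.
have muax b : mu (total1 (axis b) c) = (r + if persists b c then mu (axis b) else 0)%N.
  have := muE 1%N; rewrite mul1n expr1 => muE1.
  have [[p ->]|[np [w' w'0 ->]]] := total1_axis b c.
    by rewrite muE1 ?axis_neq0 // p.
  by rewrite muE1 ?unit_neq0 // mu1 // (negPf np).
split=> //.
- exact: (hasmult_coef mpsi).
- move=> b Sb; rewrite muax; case: ifPn => p; last by rewrite addn0; exact: npers.
  rewrite -(restr_total1 psi p) tpsi !(rmorphM (restr b)) rmorphXn /=.
  rewrite restr_axis persE //; apply: hasorder_svar.
  by rewrite -[mu _]add0n; apply: hasorderM (ordpsi' _ (SS' _ Sb p)); split; rewrite ?restr0.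
move=> b f s Sb f0 ords; rewrite mupsi muax.
have fm := hasmult_multiplicity f0; set m := multiplicity f in fm.
have [tf fE0] := total1_strict c fm; set f' := strict1 f c in tf fE0.
have f'0 : f' != 0 by apply: strict1_neq0.
rewrite tf muE //.
have [t ordt] := hasorder_ex fE0.
have tm : (t <= m)%N := strict_order_le fm ordt.
have h1 : (mu f' * r <= m * mu psi')%N.
  rewrite er; apply: leq_trans (ineq' _ _ _ SE f'0 ordt) _.
  by rewrite leq_mul2r tm orbT.
case: ifPn => p; last first.
  have ms := mult_le_order fm ords.
  rewrite addn0; have : (m * (r * r + mu psi') <= s * (r * r + mu psi'))%N.
    by rewrite leq_mul2r ms orbT.
  nia.
have S'b := SS' _ Sb p.
have [ms ords'] : (m <= s)%N /\ hasorder (restr b f') (s - m).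
  apply: hasorder_svar_inv; move: ords.
  by rewrite -(restr_total1 f p) tf rmorphM rmorphXn /= restr_axis persE.
rewrite -(subnKC ms); apply: step_inequality => //.
  exact: ineq'.
rewrite er -[mu psi']mul1n; apply: ineq' => //; first exact: axis_neq0.
by rewrite restr_axis eq_sym persE //; apply: hasorder_svar1.
Qed.

(** The order along [axis b] is the valuation from which the induction starts,
    at the point where the strict transform of the curvette meets [E_m]. *)
Definition axis_order b f := sorder (if b then f else swap f).

Lemma axis_order0 b f : restr b f != 0 -> axis_order b f = 0%N.
Proof. by move=> f0; apply: hasorder_sorder; split. Qed.

Lemma axis_order_valuation b : germ_valuation (axis_order b).
Proof.
have V : germ_valuation (fun f => sorder f).
  split=> [f g /hasorder_ex [r fr] /hasorder_ex [s gs]|w w0].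
    by rewrite (hasorder_sorder fr) (hasorder_sorder gs) (hasorder_sorder (hasorderM fr gs)).
  apply: hasorder_sorder; split=> //; apply: contra w0 => /eqP ->.
  by rewrite scoef0.
case: b => //; split=> [f g f0 g0|w w0]; rewrite /axis_order.
  have sw h : h != 0 -> swap h != 0.
    by apply: contra => /eqP e; rewrite -(swapK h) e rmorph0.
  by rewrite swapM V.1 ?sw.
exact: V.2.
Qed.

Lemma axis_order_axis b : axis_order b (axis b) = 1%N.
Proof.
rewrite /axis_order; case: b; first exact: hasorder_sorder (hasorder_svar1 _).
by rewrite swap_axis; exact: hasorder_sorder (hasorder_svar1 _).
Qed.

Lemma axis_order_total1 q f : f != 0 ->
  axis_order (isSome q) (total1 f q) = multiplicity f.
Proof.
move=> f0; have V := axis_order_valuation (isSome q).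
have [e s0] := total1_strict q (hasmult_multiplicity f0).
rewrite {1}e V.1 ?expf_neq0 ?axis_neq0 ?strict1_neq0 //.
rewrite germ_valuationX ?axis_neq0 // axis_order_axis muln1.
by rewrite axis_order0 // addn0.
Qed.

Lemma multiplicity_valuation : germ_valuation (@multiplicity k).
Proof.
split=> [f g|w w0]; first exact: multiplicityM.
apply: multiplicity_eq; split=> //; apply: contra w0 => /eqP e.
by have := coef_hform w 0 0; rewrite e coef0 /= => <-.
Qed.

Lemma total_valuation pts : germ_valuation (fun f => multiplicity (Defs.total f pts)).
Proof.
elim: pts => [|c pts [IHM IH1]]; first exact: multiplicity_valuation.
split=> [f g f0 g0|w w0] /=; last by apply: IH1; rewrite total1_00.
by rewrite total1M IHM ?total1_neq0.
Qed.

Lemma curvette_data_ext mu mu' psi S : germ_valuation mu ->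
  (forall f, f != 0 -> mu f = mu' f) ->
  curvette_data mu psi S -> curvette_data mu' psi S.
Proof.
move=> V e [p00 p0 h1 h2]; split=> //.
  by move=> b Sb; rewrite -e ?axis_neq0 //; apply: h1.
by move=> b f r Sb f0 o; rewrite -!e ?axis_neq0 //; apply: h2.
Qed.

Lemma curvette_data_unit mu psi w S : germ_valuation mu -> w 0%N 0%N != 0 ->
  curvette_data mu psi S -> curvette_data mu (w * psi) S.
Proof.
move=> V w0 [p00 p0 h1 h2]; split.
- by rewrite !scoefM0 p00 mulr0.
- by rewrite mulf_neq0 ?(unit_neq0 w0).
- move=> b Sb; rewrite rmorphM /= -[mu _]add0n; apply: hasorderM (h1 _ Sb).
  by split; rewrite ?restr0.
- have mw : mu (w * psi) = mu psi by rewrite V.1 ?(V.2 w) ?(unit_neq0 w0).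
  by move=> b f r Sb f0 o; rewrite mw; exact: h2.
Qed.

Lemma strict1_axis b c : persists b c -> strict1 (axis b) c = axis b.
Proof.
move=> p; have [[_ e]|[np _]] := total1_axis b c; last by rewrite p in np.
rewrite -[axis (isSome c)]expr1 in e.
suff nz : restr (isSome c) (axis b) != 0 by have [] := strict1_uniq (axis_neq0 k b) e nz.
rewrite restr_axis; suff -> : (isSome c == b) = false.
  by apply/eqP => /(congr1 (fun s : series k => s 1%N)) /eqP; rewrite oner_eq0.
by case: c p {e} => [a|]; case: b.
Qed.

(** At the last point the strict transform of [phi] meets [E_m] with multiplicity
    1; from there the divisor of [phi] descends one blowing-up at a time. *)
Lemma curvette_tower pts q phi : phi != 0 ->
  hasorder (restr (isSome q) (strict phi (rcons pts q))) 1 ->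
  (forall i, (i < size pts)%N ->
     ~ passes (strict (exceptional (nth q (rcons pts q) i)) (drop i.+1 (rcons pts q)))) ->
  exists psi A, phi = A * psi /\
    curvette_data (fun f => multiplicity (Defs.total f pts)) psi
      (fun b => ~ passes (strict (axis b) (rcons pts q))).
Proof.
elim: pts phi => [|c pts IH] phi phi0 ord smooth.
  rewrite /= in ord; set phi' := strict1 phi q in ord.
  have e1 : strict1 phi q = 1 * phi' by rewrite mul1r.
  have [psi [w [w0 tpsi [A eA] mpsi npers]]] := blow_down phi0 e1 ord.
  exists psi, A; split=> //.
  have V := axis_order_valuation (isSome q).
  have phi'0 : phi' != 0 by apply: strict1_neq0.
  have D0 : curvette_data (axis_order (isSome q)) phi' (fun b => b = isSome q).
    split=> //; first by case: ord => /(_ 0%N isT); rewrite restr0.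
      by move=> b ->; rewrite axis_order_axis.
    move=> b f r -> f0 o; rewrite axis_order0 //.
    by case: o => _; apply: contra => /eqP ->; rewrite scoef0.
  have Dm : curvette_data (fun f => axis_order (isSome q) (total1 f q)) psi
      (fun b => ~ passes (strict (axis b) (rcons [::] q))).
    apply: (curvette_step V D0 _ _ w0 tpsi mpsi npers) => //.
      by rewrite axis_order_axis.
    by move=> b np p; case: np; rewrite /= strict1_axis // /passes; case: (b).
  apply: curvette_data_ext Dm => [|f f0]; last exact: axis_order_total1.
  split=> [f g f0 g0|w' w'0]; last by rewrite V.2 // total1_00.
  by rewrite total1M V.1 ?total1_neq0.
set phi' := strict1 phi c; have phi'0 : phi' != 0 by apply: strict1_neq0.
have [|i lti|psi' [A' [eA' D']]] := IH phi' phi'0; first exact: ord.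
  exact: (smooth i.+1 lti).
have SE : ~ passes (strict (axis (isSome c)) (rcons pts q)).
  by have := smooth 0%N isT; rewrite /= exceptionalE drop0.
have [_ _ oE _] := D'; have oE' := oE _ SE.
have [psi [w [w0 tpsi [A eA] mpsi npers]]] := blow_down phi0 eA' oE'.
exists psi, A; split=> //.
apply: (curvette_step (total_valuation pts) D' SE erefl w0 tpsi mpsi npers).
by move=> b np p; move: np; rewrite /= strict1_axis.
Qed.

Theorem general_curvette_data pts phi : general_curvette pts phi ->
  exists S, S false /\ curvette_data (fun f => multiplicity (Defs.total f pts)) phi S.
Proof.
move=> [[nu irr] [q [trans smooth gen]]].
rewrite exceptionalE in trans; have ord := intersection_axis trans.
have phi0 : phi != 0.
  apply/eqP => z; have e : phi = 0 * 0 by rewrite z mulr0.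
  have u0 : ~ gunit (0 : germ k).
    by move=> [g /eqP]; rewrite mul0r eq_sym oner_eq0.
  by case: (irr _ _ e).
have [psi [A [eA D]]] := curvette_tower phi0 ord smooth.
exists (fun b => ~ passes (strict (axis b) (rcons pts q))); split=> //.
have unit00 w : gunit w -> w 0%N 0%N != 0.
  move=> [g /(congr1 (fun f : germ k => f 0%N 0%N))]; rewrite !scoefM0 germ1E /=.
  by move=> e; apply/eqP => z; move/eqP: e; rewrite z mul0r eq_sym oner_eq0.
rewrite eA; apply: curvette_data_unit => //; first exact: total_valuation.
case: (irr _ _ eA) => /unit00 //; case: D => -> _ _ _.
by rewrite eqxx.
Qed.

Lemma ord_EmE pts f : ord_Em pts f = multiplicity (Defs.total f pts).
Proof.
rewrite /ord_Em /sorder /multiplicity; congr least; apply: funext => n.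
by rewrite total1_Some_eq0 hform_neq0.
Qed.

End Curvettes.

(** * Normal forms for key polynomials *)

(** As the digits are less than the ratios of successive weights, the sum
    telescopes. *)
Lemma radix_bound (a K b : nat -> nat) n : (0 < K 0)%N ->
  (forall j, (j < n)%N -> (a j * K j <= K j.+1)%N) ->
  (forall j, (j < n)%N -> (b j < a j)%N) ->
  forall j, (j <= n)%N -> (\sum_(i < j) b i * K i < K j)%N.
Proof.
move=> K0 aK ba; elim=> [|j IH] jn; first by rewrite big_ord0.
rewrite big_ord_recr /=; apply: leq_trans (aK j jn).
have le : ((b j).+1 * K j <= a j * K j)%N by rewrite leq_mul2r ba ?orbT.
by apply: leq_trans le; rewrite mulSn ltn_add2r IH // ltnW.
Qed.

(** Restriction to L: the inner variable, which is [v], is set to 0. *)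
Definition at0 (k : fieldType) (A : {poly {poly k}}) : {poly k} :=
  map_poly (horner_eval 0) A.

Section At0.
Variable k : fieldType.
Implicit Types A B : {poly {poly k}}.

Lemma at0B A B : at0 (A - B) = at0 A - at0 B. Proof. exact: rmorphB. Qed.
Lemma at0M A B : at0 (A * B) = at0 A * at0 B. Proof. exact: rmorphM. Qed.
Lemma at0X A m : at0 (A ^+ m) = at0 A ^+ m. Proof. exact: rmorphXn. Qed.
Lemma at0_v : at0 'X%:P = 0 :> {poly k}.
Proof. by rewrite /at0 map_polyC /= /horner_eval hornerX. Qed.

End At0.

(** The numerical and algebraic content of the key forms in the coordinates u, v,
    with indices shifted by one: [P j] stands for x ^ (- D j) * g_(j+1), where
    [D j] is the degree of g_(j+1) in y, [K j] is the value of [P j] and [d] that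
    of [v]; [a j] and [b j i] are the exponents alpha_(j+1) and
    beta_(j+1, i+1). *)
Record key_system (k : fieldType) (n d : nat) (a D K c : nat -> nat)
    (b : nat -> nat -> nat) (P : nat -> {poly {poly k}}) (theta : nat -> k) : Prop :=
  KeySystem {
    key_deg0 : D 0 = 1%N;
    key_degS : forall j, (j < n)%N -> D j.+1 = (a j * D j)%N;
    key_a_gt0 : forall j, (j < n)%N -> (0 < a j)%N;
    key_wt0 : (0 < K 0)%N;
    key_wtS : forall j, (j < n)%N -> (a j * K j < K j.+1)%N;
    key_digit : forall j i, (j < n)%N -> (i < j)%N -> (b j i < a i)%N;
    key_wt_eq : forall j, (j < n)%N ->
      (c j * d + \sum_(i < j) b j i * K i = a j * K j)%N;
    key_at0 : forall j, (j <= n)%N -> at0 (P j) = 'X^(D j);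
    key_rec : forall j, (j < n)%N ->
      P j.+1 = P j ^+ a j
               - (theta j)%:P%:P * 'X%:P ^+ c j * \prod_(i < j) P i ^+ b j i
  }.

Section NormalForm.
Variable k : fieldType.
Variables (n d : nat) (a D K c : nat -> nat) (b : nat -> nat -> nat).
Variables (P : nat -> {poly {poly k}}) (theta : nat -> k).
Hypothesis ks : key_system n d a D K c b P theta.

Local Notation V := ('X%:P : {poly {poly k}}).
Let D0 := key_deg0 ks.
Let DS := key_degS ks.
Let a_gt0 := key_a_gt0 ks.
Let K0 := key_wt0 ks.
Let KS := key_wtS ks.
Let b_lt := key_digit ks.
Let c_wt := key_wt_eq ks.
Let P_at0 := key_at0 ks.
Let PS := key_rec ks.

Implicit Types (e : nat -> nat).

Definition wsum (w : nat -> nat) e := (\sum_(i < n.+1) e i * w i)%N.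
Definition key_mon e := \prod_(i < n.+1) P i ^+ e i.

(** The digits of [N] in the mixed radix system with weights [D]; the last one is
    unbounded, as the powers of the last key polynomial are not reduced. *)
Definition digits N i := if i == n then (N %/ D i)%N else (N %/ D i %% a i)%N.

Lemma D_gt0 j : (j <= n)%N -> (0 < D j)%N.
Proof.
by elim: j => [|j IH] jn; rewrite ?D0 // DS // muln_gt0 a_gt0 // IH // ltnW.
Qed.

Lemma wsumD w e e' : wsum w (fun i => e i + e' i)%N = (wsum w e + wsum w e')%N.
Proof. by rewrite /wsum -big_split; apply: eq_bigr => i _; rewrite mulnDl. Qed.

Lemma wsum_low w e j : (j <= n.+1)%N ->
  wsum w (fun i => if (i < j)%N then e i else 0%N) = (\sum_(i < j) e i * w i)%N.
Proof.
move=> jn; rewrite (big_ord_widen _ (fun i => e i * w i)%N jn) big_mkcond.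
by apply: eq_bigr => i _; case: ifP.
Qed.

Lemma wsum_single w x j : (j <= n)%N ->
  wsum w (fun i => if i == j then x else 0%N) = (x * w j)%N.
Proof.
move=> jn; rewrite /wsum (bigD1 (Ordinal (jn : (j < n.+1)%N))) //= eqxx big1 ?addn0 // => i ne.
case: eqP => // e; case/eqP: ne; exact: val_inj.
Qed.

Lemma key_monD e e' : key_mon (fun i => e i + e' i)%N = key_mon e * key_mon e'.
Proof. by rewrite /key_mon -big_split; apply: eq_bigr => i _; rewrite exprD. Qed.

Lemma key_mon_low e j : (j <= n.+1)%N ->
  key_mon (fun i => if (i < j)%N then e i else 0%N) = \prod_(i < j) P i ^+ e i.
Proof.
move=> jn; rewrite (big_ord_widen _ (fun i => P i ^+ e i) jn) big_mkcond.
by apply: eq_bigr => i _; case: ifP.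
Qed.

Lemma key_mon_single x j : (j <= n)%N ->
  key_mon (fun i => if i == j then x else 0%N) = P j ^+ x.
Proof.
move=> jn; rewrite /key_mon (bigD1 (Ordinal (jn : (j < n.+1)%N))) //= eqxx big1 ?mulr1 // => i ne.
case: eqP => // e; case/eqP: ne; exact: val_inj.
Qed.

Lemma key_mon_ext e e' : (forall i, (i <= n)%N -> e i = e' i) -> key_mon e = key_mon e'.
Proof. by move=> h; apply: eq_bigr => i _; rewrite h // -ltnS. Qed.

Lemma wsum_ext w e e' : (forall i, (i <= n)%N -> e i = e' i) -> wsum w e = wsum w e'.
Proof. by move=> h; apply: eq_bigr => i _; rewrite h // -ltnS. Qed.

Lemma key_mon_at0 e : at0 (key_mon e) = 'X^(wsum D e).
Proof.
rewrite /at0 rmorph_prod /=; under eq_bigr => i _.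
  rewrite rmorphXn /=.
  have -> : map_poly (horner_eval 0) (P i) = 'X^(D i) by apply: P_at0; rewrite -ltnS.
  rewrite -exprM mulnC.
  over.
by rewrite prodrXr.
Qed.

Lemma digits_sum N j : (j <= n)%N ->
  (\sum_(i < j) digits N i * D i = N %% D j)%N.
Proof.
elim: j => [|j IH] jn; first by rewrite big_ord0 D0 modn1.
rewrite big_ord_recr /= IH ?(ltnW jn) // /digits (ltn_eqF jn) DS //.
have Dj := D_gt0 (ltnW jn); have aj := a_gt0 jn.
set q := (N %/ D j)%N; have e1 := divn_eq N (D j); have e2 := divn_eq q (a j).
have l1 := ltn_pmod N Dj; have l2 := ltn_pmod q aj.
rewrite -/q in e1.
have e : N = ((q %/ a j) * (a j * D j) + (N %% D j + q %% a j * D j))%N.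
  by rewrite {1}e1 {1}e2; ring.
have lt : (N %% D j + q %% a j * D j < a j * D j)%N.
  have le : ((q %% a j).+1 * D j <= a j * D j)%N by rewrite leq_mul2r l2 orbT.
  by apply: leq_trans le; rewrite mulSn ltn_add2r.
by rewrite [in RHS]e modnMDl (modn_small lt).
Qed.

Lemma deg_digits N : wsum D (digits N) = N.
Proof.
rewrite /wsum big_ord_recr /= digits_sum // /digits eqxx addnC -divn_eq //.
Qed.

Lemma D_dvd i j : (i <= j)%N -> (j <= n)%N -> (D i %| D j)%N.
Proof.
elim: j => [|j IH]; first by rewrite leqn0 => /eqP ->.
rewrite leq_eqVlt => /orP[/eqP -> //|ij] jn.
by rewrite DS // dvdn_mull // IH // ltnW.
Qed.

Lemma digits_deg e : (forall i, (i < n)%N -> (e i < a i)%N) ->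
  forall i, (i <= n)%N -> digits (wsum D e) i = e i.
Proof.
move=> ea i i_n.
have low : (\sum_(l < i) e l * D l < D i)%N.
  by apply: radix_bound ea _ i_n; rewrite ?D0 // => j jn; rewrite DS.
have Di := D_gt0 i_n.
rewrite /wsum -(big_mkord xpredT (fun i => e i * D i)%N) (@big_cat_nat _ _ _ i) //=; last by rewrite ltnW.
rewrite big_mkord big_ltn // /digits.
have [e_n|ne] := eqVneq i n.
  move: low Di; rewrite e_n => low Di.
  by rewrite big_geq // addn0 addnC divnMDl // divn_small ?addn0.
have lt : (i < n)%N by rewrite ltn_neqAle ne.
have /dvdnP [r ->] : (D i.+1 %| \sum_(i.+1 <= l < n.+1) e l * D l)%N.
  rewrite big_nat; apply: dvdn_sum => l /andP[il ln]; apply: dvdn_mull.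
  exact: D_dvd.
rewrite DS //; have -> : (\sum_(l < i) e l * D l + (e i * D i + r * (a i * D i)) =
   (e i + r * a i) * D i + \sum_(l < i) e l * D l)%N by ring.
by rewrite divnMDl // divn_small // addn0 addnC modnMDl modn_small ?ea.
Qed.

(** An expansion of [F] in the monomials with digits as exponents, one for each
    degree in [u], all of whose terms have value at least [W]. *)
Definition normal_form W (F : {poly {poly k}}) :=
  exists T (x : nat -> {poly k}),
    F = \sum_(N < T) (x N)%:P * key_mon (digits N) /\
    forall N s, (x N)`_s != 0 -> (W <= s * d + wsum K (digits N))%N.

Lemma normal_form_widen W F : normal_form W F -> exists T, forall T', (T <= T')%N ->
  exists x : nat -> {poly k},
    F = \sum_(N < T') (x N)%:P * key_mon (digits N) /\
    forall N s, (x N)`_s != 0 -> (W <= s * d + wsum K (digits N))%N.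
Proof.
move=> [T [x [-> xW]]]; exists T => T' TT'.
exists (fun N => if (N < T)%N then x N else 0); split; last first.
  by move=> N s; case: ifP => [_|_]; rewrite ?coef0 ?eqxx //; apply: xW.
rewrite (big_ord_widen _ (fun N => (x N)%:P * key_mon (digits N)) TT') big_mkcond.
by apply: eq_bigr => i _; case: ifP => // _; rewrite mul0r.
Qed.

Lemma normal_form0 W : normal_form W 0.
Proof.
by exists 0%N, (fun _ => 0); split=> [|N s]; rewrite ?big_ord0 // coef0 eqxx.
Qed.

Lemma normal_formD W F G : normal_form W F -> normal_form W G -> normal_form W (F + G).
Proof.
move=> /normal_form_widen [T1 H1] /normal_form_widen [T2 H2].
have [x1 [-> w1]] := H1 _ (leq_maxl T1 T2); have [x2 [-> w2]] := H2 _ (leq_maxr T1 T2).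
exists (maxn T1 T2), (fun N => x1 N + x2 N); split.
  by rewrite -big_split; apply: eq_bigr => i _; rewrite polyCD mulrDl.
move=> N s; rewrite coefD; have [e|/w1 //] := eqVneq (x1 N)`_s 0.
by rewrite e add0r; apply: w2.
Qed.

Lemma normal_form_sum W (I : Type) (r : seq I) (Q : pred I) (F : I -> {poly {poly k}}) :
  (forall i, Q i -> normal_form W (F i)) -> normal_form W (\sum_(i <- r | Q i) F i).
Proof.
by move=> h; apply: big_ind => //; [exact: normal_form0|exact: normal_formD].
Qed.

Lemma normal_formZ W y s F : normal_form W F ->
  normal_form (s * d + W) (y%:P%:P * V ^+ s * F).
Proof.
move=> [T [x [-> xW]]]; exists T, (fun N => y *: ('X^s * x N)); split.
  rewrite mulr_sumr; apply: eq_bigr => i _.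
  rewrite mulrA; congr (_ * _).
  by rewrite -mul_polyC !polyCM rmorphXn /= mulrA.
move=> N t; rewrite coefZ coefXnM; case: ltnP => ts; first by rewrite mulr0 eqxx.
rewrite mulf_eq0 negb_or => /andP[_ /xW h].
apply: leq_trans (leq_add (leqnn (s * d)) h) _.
by rewrite addnA -mulnDl subnKC.
Qed.

Lemma normal_form_mono W W' F : (W' <= W)%N -> normal_form W F -> normal_form W' F.
Proof.
by move=> le [T [x [eF xW]]]; exists T, x; split=> // N s /xW; apply: leq_trans.
Qed.

Lemma normal_form_digits N : normal_form (wsum K (digits N)) (key_mon (digits N)).
Proof.
exists N.+1, (fun M => if M == N then 1 else 0); split; last first.
  move=> M s; case: (M =P N) => [->|_]; last by rewrite coef0 eqxx.
  by rewrite leq_addl.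
rewrite big_ord_recr /= eqxx mul1r big1 ?add0r // => i _.
by rewrite (ltn_eqF (ltn_ord i)) mul0r.
Qed.

(** Induction on the degree in [u].  If the exponent of P_j is at least [a j], the
    recursion replaces [P j ^ a j] by [P j.+1], which keeps the degree and raises
    the value, plus a monomial of the same value and smaller degree.  The first
    replacement moves exponents to larger indices, so it cannot be repeated
    forever within one degree. *)
Lemma normal_form_mon e : normal_form (wsum K e) (key_mon e).
Proof.
pose sec e := wsum (fun i => n.+1 - i)%N e.
suff H : forall N M e, wsum D e = N -> (sec e < M)%N -> normal_form (wsum K e) (key_mon e).
  exact: H (erefl _) (ltnSn _).
elim/ltn_ind => N IHN; elim=> // M IHM {}e degN secM.
have [/forallP|/forallPn[j]] := boolP [forall i : 'I_n, e i < a i]%N.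
  move=> h; have ea i (lt : (i < n)%N) : (e i < a i)%N := h (Ordinal lt).
  rewrite (key_mon_ext (fun i l => esym (digits_deg ea l))).
  by rewrite (wsum_ext K (fun i l => esym (digits_deg ea l))); apply: normal_form_digits.
rewrite -leqNgt => aej; have jn := ltn_ord j; set j' : nat := j in aej jn.
move: j' aej jn => {}j aej jn.
pose e0 i := (e i - if i == j then a j else 0)%N.
pose e1 i := (e0 i + if i == j.+1 then 1 else 0)%N.
pose e2 i := (e0 i + if (i < j)%N then b j i else 0)%N.
have ee i : e i = (e0 i + if i == j then a j else 0)%N.
  by rewrite /e0; case: eqP => [->|_]; rewrite ?subnK // subn0 addn0.
have jn1 : (j <= n.+1)%N by lia.
have jn' : (j <= n)%N by lia.
have linE w : wsum w e = (wsum w e0 + a j * w j)%N.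
  by rewrite (wsum_ext w (fun i _ => ee i)) wsumD wsum_single.
have lin1 w : wsum w e1 = (wsum w e0 + w j.+1)%N.
  by rewrite wsumD wsum_single // mul1n.
have lin2 w : wsum w e2 = (wsum w e0 + \sum_(i < j) b j i * w i)%N.
  by rewrite wsumD wsum_low.
have -> : key_mon e = key_mon e1 + (theta j)%:P%:P * V ^+ c j * key_mon e2.
  rewrite (key_mon_ext (fun i _ => ee i)) !key_monD !key_mon_single // key_mon_low //.
  rewrite expr1 PS //.
  ring.
have KSj := KS jn; have DSj := DS jn.
apply: normal_formD.
  apply: (@normal_form_mono (wsum K e1)).
    by rewrite linE lin1 leq_add2l ltnW.
  apply: IHM; first by rewrite lin1 DSj -degN linE.
  apply: leq_trans (_ : sec e <= _)%N; last by rewrite -ltnS.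
  rewrite /sec lin1 linE ltn_add2l subSS subSn //.
  exact: leq_pmull (a_gt0 jn).
have -> : wsum K e = (c j * d + wsum K e2)%N.
  by rewrite linE lin2 -c_wt //; lia.
apply: normal_formZ.
have Dlow : (\sum_(i < j) b j i * D i < D j)%N.
  apply: (@radix_bound a D (b j) j) => //; first by rewrite D0.
    by move=> i ij; rewrite DS //; lia.
  by move=> i ij; apply: b_lt.
apply: (IHN (wsum D e2)) (erefl _) (ltnSn _).
by rewrite -degN linE lin2 ltn_add2l; have := a_gt0 jn; nia.
Qed.

(** On v = 0 the monomial with the digits of [N] restricts to [u ^ N], so the terms
    of an expansion do not interfere. *)
Lemma normal_form_coef0 T (x : nat -> {poly k}) N :
  (at0 (\sum_(M < T) (x M)%:P * key_mon (digits M)))`_N =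
  if (N < T)%N then (x N)`_0 else 0.
Proof.
rewrite /at0 rmorph_sum coef_sum.
have E (M : 'I_T) : (map_poly (horner_eval 0) ((x M)%:P * key_mon (digits M)))`_N =
    if N == M then (x M)`_0 else 0.
  have := key_mon_at0 (digits M); rewrite /at0 rmorphM /= map_polyC /= => ->.
  rewrite deg_digits coefCM coefXn /horner_eval horner_coef0.
  by case: eqP; rewrite ?mulr1 ?mulr0.
under eq_bigr => M _ do rewrite E.
case: ltnP => [NT|TN].
  rewrite (bigD1 (Ordinal NT)) //= eqxx big1 ?addr0 // => M ne.
  by case: eqP => // e; case/eqP: ne; apply: val_inj.
rewrite big1 // => M _; case: eqP => // e; have := ltn_ord M; lia.
Qed.

(** All the coefficients of an expansion of [v F] vanish at v = 0, so each of them
    can be divided by [v]. *)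
Lemma normal_form_peel W F : normal_form W (V * F) -> normal_form (W - d) F.
Proof.
move=> [T [x [eF xW]]].
have x0 N : (N < T)%N -> (x N)`_0 = 0.
  move=> NT; have := normal_form_coef0 T x N; rewrite NT -eF => <-.
  by rewrite /at0 rmorphM /= map_polyC /= /horner_eval hornerX mul0r coef0.
pose y N := \poly_(s < size (x N)) (x N)`_s.+1.
have yE N s : (y N)`_s = (x N)`_s.+1.
  by rewrite coef_poly; case: ltnP => // le; rewrite nth_default // ltnW.
have xy N : (N < T)%N -> x N = y N * 'X.
  move=> /x0 z; apply/polyP => s; rewrite coefMX.
  by case: s => [|s] //=; rewrite yE.
exists T, y; split; last first.
  by move=> N s; rewrite yE => /xW; rewrite mulSn; lia.
have V0 : V != 0 by rewrite polyC_eq0 polyX_eq0.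
apply: (mulfI V0); rewrite eF mulr_sumr; apply: eq_bigr => N _.
by rewrite xy // mulrA polyCM [_ * V]mulrC.
Qed.

Lemma normal_form_peelX W M F : normal_form (M * d + W) (V ^+ M * F) -> normal_form W F.
Proof.
elim: M F => [|M IH] F; first by rewrite mul1r.
rewrite exprS -mulrA => /normal_form_peel h; apply: IH.
by apply: normal_form_mono h; rewrite mulSn -addnA addKn.
Qed.

Lemma normal_form_bound W F N : normal_form W F -> (at0 F)`_N != 0 ->
  (W <= wsum K (digits N))%N.
Proof.
move=> [T [x [-> xW]]]; rewrite normal_form_coef0; case: ifP => [_|]; last by rewrite eqxx.
by move=> /xW; rewrite mul0n.
Qed.

End NormalForm.

(** * Functions on the plane as germs at p *)

Section Evaluation.
Variables (k F : comNzRingType) (phi : {rmorphism k -> F}) (x y : F).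
Implicit Types A B : {poly {poly k}}.

Definition eval2 A := (map_poly (map_poly phi) A).[x%:P].[y].

Lemma eval2B A B : eval2 (A - B) = eval2 A - eval2 B.
Proof. by rewrite /eval2 rmorphB !hornerE. Qed.
Lemma eval2M A B : eval2 (A * B) = eval2 A * eval2 B.
Proof. by rewrite /eval2 rmorphM !hornerM. Qed.
Lemma eval2_1 : eval2 1 = 1.
Proof. by rewrite /eval2 rmorph1 !hornerC. Qed.
Lemma eval2X : eval2 'X = x.
Proof. by rewrite /eval2 map_polyX hornerX hornerC. Qed.
Lemma eval2Y : eval2 'X%:P = y.
Proof. by rewrite /eval2 map_polyC /= map_polyX hornerC hornerX. Qed.
Lemma eval2C a : eval2 a%:P%:P = phi a.
Proof. by rewrite /eval2 !map_polyC /= map_polyC !hornerC. Qed.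

Lemma eval2_sum A I J : (size A <= I)%N -> (forall i, (size (A`_i)%R <= J)%N) ->
  eval2 A = \sum_(i < I) \sum_(j < J) phi A`_i`_j * x ^+ i * y ^+ j.
Proof.
move=> sA sJ; rewrite {1}/eval2 [X in X.[y]](@horner_coef_wide _ I); last first.
  exact: leq_trans (size_poly _ _) _.
rewrite horner_sum; apply: eq_bigr => i _.
rewrite hornerM -rmorphXn hornerC coef_map /=.
rewrite (@horner_coef_wide _ J); last exact: leq_trans (size_poly _ _) _.
rewrite mulr_suml; apply: eq_bigr => j _; rewrite coef_map /=.
by rewrite mulrAC.
Qed.

End Evaluation.

Section Coordinates.
Variable k : fieldType.
Implicit Types (A B F : {poly {poly k}}).

Fact fconst_is_additive : zmod_morphism (@fconst k).
Proof. by move=> x y; rewrite /fconst !rmorphB. Qed.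
Fact fconst_is_multiplicative : monoid_morphism (@fconst k).
Proof. by split=> [|x y]; rewrite /fconst ?rmorph1 ?rmorphM. Qed.
HB.instance Definition _ :=
  GRing.isZmodMorphism.Build k (funfield k) (@fconst k) fconst_is_additive.
HB.instance Definition _ :=
  GRing.isMonoidMorphism.Build k (funfield k) (@fconst k) fconst_is_multiplicative.

Fact at_p_is_additive : zmod_morphism (@at_p k).
Proof. by move=> A B; apply: eval2B. Qed.
Fact at_p_is_multiplicative : monoid_morphism (@at_p k).
Proof. by split=> [|A B]; [apply: eval2_1 | apply: eval2M]. Qed.
HB.instance Definition _ := GRing.isZmodMorphism.Build
  {poly {poly k}} (funfield k) (@at_p k) at_p_is_additive.
HB.instance Definition _ := GRing.isMonoidMorphism.Build
  {poly {poly k}} (funfield k) (@at_p k) at_p_is_multiplicative.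

Lemma at_p_u : at_p 'X = fy k / fx k.
Proof. exact: eval2X. Qed.
Lemma at_p_v : at_p ('X%:P) = (fx k)^-1.
Proof. exact: eval2Y. Qed.
Lemma at_p_c (a : k) : at_p (a%:P%:P) = fconst a.
Proof. exact: eval2C. Qed.

Lemma at_pD A B : at_p (A + B) = at_p A + at_p B. Proof. exact: (rmorphD (@at_p k)). Qed.
Lemma at_pB A B : at_p (A - B) = at_p A - at_p B. Proof. exact: (rmorphB (@at_p k)). Qed.
Lemma at_pM A B : at_p (A * B) = at_p A * at_p B. Proof. exact: (rmorphM (@at_p k)). Qed.
Lemma at_pX A m : at_p (A ^+ m) = at_p A ^+ m. Proof. exact: (rmorphXn (@at_p k)). Qed.
Lemma at_p1 : at_p (1 : {poly {poly k}}) = 1. Proof. exact: (rmorph1 (@at_p k)). Qed.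
Lemma at_p0 : at_p (0 : {poly {poly k}}) = 0. Proof. exact: (rmorph0 (@at_p k)). Qed.
Lemma at_p_prod (I : Type) (r : seq I) (F : I -> {poly {poly k}}) :
  at_p (\prod_(i <- r) F i) = \prod_(i <- r) at_p (F i).
Proof. exact: (big_morph _ at_pM at_p1). Qed.
Lemma at_p_bigsum (I : Type) (r : seq I) (F : I -> {poly {poly k}}) :
  at_p (\sum_(i <- r) F i) = \sum_(i <- r) at_p (F i).
Proof. exact: (big_morph _ at_pD at_p0). Qed.

Lemma fx_neq0 : fx k != 0.
Proof. by rewrite tofrac_eq0 polyX_eq0. Qed.

Lemma at_p_sum A I J : (size A <= I)%N -> (forall i, (size (A`_i)%R <= J)%N) ->
  at_p A = \sum_(i < I) \sum_(j < J) fconst A`_i`_j * (fy k / fx k) ^+ i * (fx k)^-1 ^+ j.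
Proof. exact: eval2_sum. Qed.

Let exponents_add_up p q x y : (x < p)%N -> (y < q)%N -> (p + q = p + q - x - y + x + y)%N.
Proof. lia. Qed.

Let clear_term (F : fieldType) (x y z : F) m i j : x != 0 ->
  x ^+ m * x ^+ i * x ^+ j * (z * (y / x) ^+ i * x^-1 ^+ j) = z * y ^+ i * x ^+ m.
Proof.
by move=> x0; rewrite expr_div_n exprVn; field; rewrite !expf_neq0.
Qed.

(** The polynomial in x and y that represents A(y / x, 1 / x) times
    [x ^ (I + J)]. *)
Definition clear_denominators A I J : {poly {poly k}} :=
  \sum_(i < I) \sum_(j < J) (A`_i`_j *: 'X^i)%:P * 'X^(I + J - i - j).

Lemma at_p_clear A I J : (size A <= I)%N -> (forall i, (size (A`_i)%R <= J)%N) ->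
  fx k ^+ (I + J) * at_p A = tofrac (clear_denominators A I J).
Proof.
move=> sI sJ; rewrite (at_p_sum sI sJ) mulr_sumr /clear_denominators rmorph_sum.
apply: eq_bigr => i _; rewrite mulr_sumr rmorph_sum; apply: eq_bigr => j _.
have -> : fx k ^+ (I + J) = fx k ^+ (I + J - i - j) * fx k ^+ i * fx k ^+ j.
  by rewrite -!exprD; congr (_ ^+ _); apply: exponents_add_up.
rewrite clear_term ?fx_neq0 // [RHS]tofracM -mul_polyC polyCM tofracM; congr (_ * _ * _).
  by rewrite rmorphXn /= tofracXn.
by rewrite tofracXn.
Qed.

Lemma coef_bound A : exists J, forall i, (size (A`_i)%R <= J)%N.
Proof.
exists (\max_(i < size A) size (A`_i)%R)%N => i.
have [lt|ge] := ltnP i (size A); last by rewrite nth_default // size_poly0.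
exact: (leq_bigmax (Ordinal lt)).
Qed.

Lemma laurent_at_p A : laurent (at_p A).
Proof.
have [J sJ] := coef_bound A.
exists (size A + J)%N, (clear_denominators A (size A) J).
by rewrite -(at_p_clear (leqnn _) sJ) mulKf // expf_neq0 // fx_neq0.
Qed.

Lemma at_p_eq0 A : (at_p A == 0) = (A == 0).
Proof.
apply/eqP/eqP => [e|->]; last exact: (rmorph0 (@at_p k)).
have [J sJ] := coef_bound A.
have := at_p_clear (leqnn _) sJ; rewrite e mulr0 => /esym /eqP.
rewrite tofrac_eq0 => /eqP e'; pose M := (size A + J)%N.
apply/polyP => i0; apply/polyP => j0; rewrite !coef0.
have [lti|gei] := ltnP i0 (size A); last by rewrite (nth_default _ gei) coef0.
have [ltj|gej] := ltnP j0 J; last by rewrite nth_default // (leq_trans (sJ _)).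
have := congr1 (fun p : {poly {poly k}} => p`_(M - i0 - j0)`_i0) e'.
rewrite /= /clear_denominators -/M !coef0 coef_sum coef_sum.
rewrite (bigD1 (Ordinal lti)) //= [X in _ + X]big1 ?addr0 => [|i ne].
  rewrite coef_sum coef_sum (bigD1 (Ordinal ltj)) //= [X in _ + X]big1 ?addr0 => [|j ne].
    by rewrite coefCM coefXn eqxx mulr1 coefZ coefXn eqxx mulr1.
  rewrite coefCM coefXn (_ : (_ == _) = false) ?mulr0 ?coef0 //.
  apply: contraNF ne => /eqP h; apply/eqP/val_inj => /=.
  by have := ltn_ord j; rewrite /M in h; lia.
rewrite coef_sum coef_sum big1 // => j _; rewrite coefCM coefXn.
case: eqP => _; rewrite ?mulr0 ?coef0 // mulr1 coefZ coefXn.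
rewrite (_ : (_ == _) = false) ?mulr0 //.
by apply: contraNF ne => /eqP h; apply/eqP/val_inj.
Qed.

Lemma at_p_inj : injective (@at_p k).
Proof.
move=> A B e; apply/eqP; rewrite -subr_eq0 -at_p_eq0.
by rewrite (rmorphB (@at_p k)) /= e subrr.
Qed.

Fact germ_of_poly_is_additive : zmod_morphism (@germ_of_poly k).
Proof. by move=> A B; apply: germP => i j /=; rewrite !coefB. Qed.
Fact germ_of_poly_is_multiplicative : monoid_morphism (@germ_of_poly k).
Proof.
split=> [|A B]; apply: germP => i j.
  rewrite germ1E /= coef1; case: i => [|i] /=; rewrite ?coef1 ?coef0 //.
by rewrite germME /= coefM coef_sum; apply: eq_bigr => p _; rewrite coefM.
Qed.
HB.instance Definition _ := GRing.isZmodMorphism.Build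
  {poly {poly k}} (germ k) (@germ_of_poly k) germ_of_poly_is_additive.
HB.instance Definition _ := GRing.isMonoidMorphism.Build
  {poly {poly k}} (germ k) (@germ_of_poly k) germ_of_poly_is_multiplicative.

Lemma germ_of_poly_eq0 A : (germ_of_poly A == 0) = (A == 0).
Proof.
apply/eqP/eqP => [e|->]; last exact: (rmorph0 (@germ_of_poly k)).
apply/polyP => i; apply/polyP => j; rewrite !coef0.
have e2 : A`_i`_j = (0 : germ k) i j := congr1 (fun f : germ k => f i j) e.
by rewrite e2 !scoef0.
Qed.

Lemma germ_of_poly_u : germ_of_poly 'X = gu k.
Proof.
apply: germP => i j; rewrite guE /= coefX.
by case: eqP => _; rewrite ?coef1 ?coef0.
Qed.

Lemma germ_of_poly_v : germ_of_poly ('X%:P) = gv k.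
Proof.
apply: germP => i j; rewrite gvE /= coefC.
by case: eqP => _; rewrite ?coefX ?coef0.
Qed.

End Coordinates.

(** * Values of truncations *)

Section Values.
Variable k : fieldType.
Implicit Types (f g phi : germ k) (pts : seq (option k)) (A B : {poly {poly k}}).

Definition vanishes_to m f := forall i j, (i + j < m)%N -> f i j = 0.

Lemma vanishes_to_mult m f : f != 0 -> vanishes_to m f -> (m <= multiplicity f)%N.
Proof.
move=> f0 fm; have [_] := hasmult_multiplicity f0; rewrite leqNgt; apply: contra => lt.
apply/eqP/polyP => j; rewrite coef_hform coef0; case: leqP => // ji.
by rewrite fm // subnK.
Qed.

Lemma mult_vanishes_to f : f != 0 -> vanishes_to (multiplicity f) f.
Proof. by move=> /hasmult_multiplicity /hasmult_coef. Qed.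

Lemma vanishes_to_total1 m f c : vanishes_to m f -> vanishes_to m (total1 f c).
Proof.
move=> fm i j ij; case: c => [a|] /=.
  rewrite /total1 /= big1 // => x _; rewrite fm ?mul0r ?mul0rn //.
  by rewrite subnK; [lia | rewrite -ltnS].
by rewrite /total1 /=; case: leqP => // le; rewrite fm // subnKC //; lia.
Qed.

Lemma vanishes_to_total m f pts : vanishes_to m f -> vanishes_to m (Defs.total f pts).
Proof. by elim: pts f => //= c pts IH f /(vanishes_to_total1 c) /IH. Qed.

Lemma total_neq0 f pts : f != 0 -> Defs.total f pts != 0.
Proof. by elim: pts f => //= c pts IH f /(total1_neq0 c) /IH. Qed.

Lemma totalD f g pts : Defs.total (f + g) pts = Defs.total f pts + Defs.total g pts.
Proof.
elim: pts f g => //= c pts IH f g.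
by rewrite -IH; congr (Defs.total _ _); exact: (rmorphD (blowup c)).
Qed.

Lemma total_00 f pts : Defs.total f pts 0%N 0%N = f 0%N 0%N.
Proof. by elim: pts f => //= c pts IH f; rewrite IH total1_00. Qed.

Lemma value_gt0 f pts : f != 0 -> f 0%N 0%N = 0 ->
  (0 < multiplicity (Defs.total f pts))%N.
Proof.
move=> f0 f00; apply: vanishes_to_mult; first exact: total_neq0.
by move=> [|i] [|j] // _; rewrite total_00.
Qed.

Definition truncate M f : {poly {poly k}} := \poly_(i < M) \poly_(j < M) f i j.

Lemma coef_truncate M f i j : (i < M)%N -> (j < M)%N -> (truncate M f)`_i`_j = f i j.
Proof. by move=> iM jM; rewrite coef_poly iM coef_poly jM. Qed.

(** Blowing up does not decrease the multiplicity of the total transform, so terms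
    of degree at least [M] have value at least [M]. *)
Lemma value_truncate pts f M m : f != 0 -> germ_of_poly (truncate M f) != 0 ->
  (m <= M)%N -> (m <= multiplicity (Defs.total f pts))%N ->
  (m <= multiplicity (Defs.total (germ_of_poly (truncate M f)) pts))%N.
Proof.
move=> f0 tf0 mM mf; apply: vanishes_to_mult; first exact: total_neq0.
set F := germ_of_poly _; have -> : F = f + (F - f) by rewrite addrC subrK.
have h : vanishes_to m (Defs.total (F - f) pts).
  apply: vanishes_to_total => i j ij.
  change (F i j - f i j = 0); rewrite /F /= coef_truncate ?subrr //; lia.
move=> i j ij; rewrite totalD.
change (Defs.total f pts i j + Defs.total (F - f) pts i j = 0).
rewrite h // addr0; apply: mult_vanishes_to; first exact: total_neq0.
exact: leq_trans mf.
Qed.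

End Values.

(** * Key forms in the coordinates at p *)

(** The recursion of the key forms, divided by the appropriate power of x. *)
Lemma clear_powers (F : fieldType) (x y t p : F) (a D c s : nat) (beta : int) :
  x != 0 -> (a * D)%:Z = c%:Z + s%:Z + beta ->
  (y / x ^+ D) ^+ a - t * x ^- c * (p * x ^- s) =
  (y ^+ a - t * (x ^ beta * p)) / x ^+ (a * D).
Proof.
move=> x0 e; rewrite mulrBl expr_div_n -exprM mulnC; congr (_ - _).
rewrite [X in _ = _ / X]exprnP e !expfzDr // -!exprnP.
have xb : x ^ beta != 0 by rewrite expfz_neq0.
by field; rewrite xb !expf_neq0.
Qed.

Lemma gather_powers (F : fieldType) (x q p : F) M N E : x != 0 -> (E <= M + N)%N ->
  x ^- M * (x ^- N * (q * (x ^+ E * p))) = q * x ^- (M + N - E) * p.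
Proof.
move=> x0 le; have xN0 m : x ^+ m != 0 by rewrite expf_neq0.
apply: (mulfI (mulf_neq0 (xN0 M) (xN0 N))).
have -> : x ^+ M * x ^+ N = x ^+ (M + N - E) * x ^+ E by rewrite -!exprD subnK.
have e : x ^+ (M + N - E) * x ^+ E * x ^- M * x ^- N = 1.
  by rewrite -exprD subnK // exprD; field; rewrite !xN0.
transitivity (x ^+ (M + N - E) * x ^+ E * x ^- M * x ^- N * (q * (x ^+ E * p))).
  by ring.
by rewrite e; field; rewrite xN0.
Qed.

Section KeyForms.
Variable k : fieldType.
Variables (pts : seq (option k)) (nu : funfield k -> int).
Hypothesis hnu : divisorial_valuation pts nu.
Implicit Types (A B : {poly {poly k}}).

Definition value A := multiplicity (Defs.total (germ_of_poly A) pts).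
Local Notation d := (value 'X%:P).

Let V0 : ('X%:P : {poly {poly k}}) != 0.
Proof. by rewrite polyC_eq0 polyX_eq0. Qed.

Lemma value1 : value 1 = 0%N.
Proof.
have [_ h] := total_valuation pts; apply: h.
by rewrite (rmorph1 (@germ_of_poly k)) germ1E oner_neq0.
Qed.

Lemma valueM A B : A != 0 -> B != 0 -> value (A * B) = (value A + value B)%N.
Proof.
move=> A0 B0; rewrite /value (rmorphM (@germ_of_poly k)) /=.
by have [-> ] := total_valuation pts; rewrite ?germ_of_poly_eq0.
Qed.

Lemma valueX A n : A != 0 -> value (A ^+ n) = (n * value A)%N.
Proof.
move=> A0; elim: n => [|n IH]; first by rewrite value1.
by rewrite exprS valueM ?expf_neq0 // IH.
Qed.

Lemma nu_quotient A B : A != 0 -> B != 0 ->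
  nu (at_p A / at_p B) = (value A)%:Z - (value B)%:Z.
Proof. by move=> A0 B0; rewrite hnu // !ord_EmE. Qed.

Lemma at_pXv n : at_p ('X%:P ^+ n) = fx k ^- n.
Proof. by rewrite at_pX at_p_v exprVn. Qed.

(** Dividing by [x ^ D] shifts the value by [D d], because [1 / x] is [v]. *)
Lemma nu_scaled A D h : A != 0 -> at_p A = h / fx k ^+ D ->
  - nu h = (D * d)%:Z - (value A)%:Z.
Proof.
move=> A0 e; have -> : h = at_p A / at_p ('X%:P ^+ D).
  by rewrite at_pXv invrK e divfK // expf_neq0 // fx_neq0.
by rewrite nu_quotient ?expf_neq0 // valueX // opprB.
Qed.

Lemma d_gt0 : (0 < d)%N.
Proof.
apply: value_gt0; rewrite ?germ_of_poly_eq0 //.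
by rewrite germ_of_poly_v gvE.
Qed.

Lemma nu_fx : - nu (fx k) = d%:Z.
Proof.
rewrite (@nu_scaled 1 1) ?oner_neq0 ?mul1n ?value1 ?subr0 //.
by rewrite at_p1 expr1 divff // fx_neq0.
Qed.

Lemma at0_neq0 A D : at0 A = 'X^D -> A != 0.
Proof.
by apply: contra_eqN => /eqP ->; rewrite /at0 rmorph0 eq_sym -size_poly_eq0 size_polyXn.
Qed.

Variables (n : nat) (g : nat -> funfield k).
Hypothesis hg : key_forms nu n g.

(** The exponent [c j] of [v] is what remains of the exponents of [x].  It is
    positive: the linear relation between the weights gives
    c_j d = a_j K_j - (sum of b_ji K_i), and the sum, a mixed radix numeral with
    weights [K], is less than K_j. *)
Lemma key_system_exists : exists a D K c b P theta,
  [/\ key_system n d a D K c b P theta,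
      forall j, (j <= n)%N -> K j = value (P j)
    & forall j, (j <= n)%N -> at_p (P j) = g j.+1 / fx k ^+ D j].
Proof.
have [al [be [th [_ [g0 g1] P1 P2 _]]]] := hg.
pose a i := al i.+1; pose D j := (\prod_(l < j) a l)%N.
pose b j i := `|be j.+1 i.+1|%N.
pose z j : int := (a j * D j)%:Z - (\sum_(i < j) b j i * D i)%N%:Z - be j.+1 0%N.
pose c j := `|z j|%N.
pose theta j := th j.+1.
pose step j (P : nat -> {poly {poly k}}) := if j is i.+1 then
   P i ^+ a i - (theta i)%:P%:P * 'X%:P ^+ c i * \prod_(l < i) P l ^+ b i l else 'X.
have [|P HP] := @strong_rec_ex {poly {poly k}} 0 step.
  move=> [|j] F G e //=; rewrite e //; congr (_ - _ * _).
  by apply: eq_bigr => l _; rewrite e // ltnS ltnW.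
pose K j := value (P j).
have DS j : D j.+1 = (a j * D j)%N by rewrite /D big_ord_recr mulnC.
have a0 j : (j < n)%N -> (0 < a j)%N.
  by move=> jn; have [[]] := P1 j.+1 jn.
have b_lt j i : (j < n)%N -> (i < j)%N -> (b j i < a i)%N.
  move=> jn ij; have [_ _ _ /(_ i.+1 ij)] := P1 j.+1 jn.
  by rewrite /b /a; case: (be _ _) => // m /andP[_]; rewrite ltz_nat.
have bE j i : (j < n)%N -> (i < j)%N -> be j.+1 i.+1 = (b j i)%:Z.
  move=> jn ij; have [_ _ _ /(_ i.+1 ij) /andP[h _]] := P1 j.+1 jn.
  by rewrite /b gez0_abs.
have P0E : P 0%N = 'X by rewrite HP.
have PS j : P j.+1 = P j ^+ a j - (theta j)%:P%:P * 'X%:P ^+ c j * \prod_(l < j) P l ^+ b j l.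
  by rewrite [LHS]HP.
pose good j := at_p (P j) = g j.+1 / fx k ^+ D j /\ at0 (P j) = 'X^(D j).
have wE j : good j -> - nu (g j.+1) = (D j * d)%:Z - (K j)%:Z.
  by move=> [e e0]; apply: nu_scaled => //; apply: at0_neq0 e0.
(* The given inequality compares the weights of successive key forms; the
   degrees cancel and it becomes an inequality of values in the other sense. *)
have KS j : (j < n)%N -> good j -> good j.+1 -> (a j * K j < K j.+1)%N.
  move=> jn gj gj1; have [_ + _ _] := P1 j.+1 jn.
  rewrite !wE // DS -/(a j) => lt; nia.
have K0 : (0 < K 0)%N.
  apply: value_gt0; rewrite ?germ_of_poly_eq0 P0E ?polyX_eq0 //.
  by rewrite germ_of_poly_u guE.
have wt_eq j : (j < n)%N -> (forall i, (i <= j)%N -> good i) ->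
   (0 < z j) /\ (c j * d + \sum_(i < j) b j i * K i = a j * K j)%N.
  move=> jn gj.
  have SK : (\sum_(i < j) b j i * K i < K j)%N.
    apply: (@radix_bound a K (b j) j) => // i ij; last exact: b_lt.
    have i_n : (i < n)%N by apply: ltn_trans jn.
    by apply: ltnW; apply: KS => //; apply: gj => //; apply: ltnW.
  have [_ _ + _] := P1 j.+1 jn.
  rewrite big_ord_recl /= g0 nu_fx wE; last exact: gj.
  have -> : \sum_(i < j) be j.+1 (bump 0 i) * - nu (g (bump 0 i)) =
      (\sum_(i < j) b j i * D i)%N%:Z * d%:Z - (\sum_(i < j) b j i * K i)%N%:Z.
    rewrite !(big_morph Posz PoszD (erefl _)) mulr_suml -sumrB; apply: eq_bigr => i _.
    rewrite /bump leq0n add1n bE // wE; last by apply: gj; apply: ltnW.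
    by rewrite !PoszM; ring.
  move=> e.
  have aj := a0 j jn.
  set SD := (\sum_(i < j) b j i * D i)%N in e; set SB := (\sum_(i < j) _ * K i)%N in e SK *.
  have zd : z j * d%:Z = (a j * K j)%N%:Z - SB%:Z.
    by rewrite /z -/SD; move: e; rewrite -/(a j) -mulr_natr natz !PoszM; lia.
  have aK : (K j <= a j * K j)%N by rewrite leq_pmull.
  have z0 : 0 < z j.
    have : 0 < z j * d%:Z by rewrite zd; lia.
    by rewrite pmulr_lgt0 // ltz_nat d_gt0.
  split=> //; apply/eqP; rewrite -eqz_nat PoszD PoszM /c gez0_abs ?ltW // zd.
  by rewrite subrK.
have step_good j : (j < n)%N -> (forall i, (i <= j)%N -> good i) -> good j.+1.
  move=> jn gj; have [z0 _] := wt_eq j jn gj.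
  have c0 : (0 < c j)%N by rewrite /c; lia.
  split; last first.
    have [_ e0] := gj j (leqnn _).
    rewrite PS at0B !at0M !at0X at0_v e0 expr0n (gtn_eqF c0).
    by rewrite mulr0 mul0r subr0 -exprM DS mulnC.
  rewrite PS at_pB !at_pM at_pX at_pXv at_p_c at_p_prod.
  have [-> _] := gj j (leqnn _).
  have [_ ->] := P2 j.+1 jn.
  rewrite big_ord_recl g0.
  have -> : \prod_(l < j) at_p (P l ^+ b j l) =
      \prod_(l < j) g l.+1 ^+ b j l * fx k ^- (\sum_(l < j) b j l * D l)%N.
    rewrite -exprVn -prodrXr -big_split; apply: eq_bigr => l _ /=.
    have [e _] := gj l (ltnW (ltn_ord l)).
    by rewrite at_pX e exprMn mulnC exprM exprVn.
  have -> : \prod_(i < j) g (lift ord0 i) ^ be j.+1 (lift ord0 i) =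
      \prod_(l < j) g l.+1 ^+ b j l.
    by apply: eq_bigr => l _; rewrite lift0 bE.
  rewrite DS -/(a j); apply: clear_powers (fx_neq0 k) _.
  by rewrite /c gez0_abs ?ltW // /z; ring.
have allgood j : (j <= n)%N -> good j.
  elim/ltn_ind: j => -[_ _|j IH jn]; last first.
    by apply: step_good => // i ij; apply: IH => //; apply: leq_trans ij (ltnW jn).
  split; first by rewrite P0E at_p_u g1 /D big_ord0 expr1.
  by rewrite P0E /at0 map_polyX /D big_ord0 expr1.
exists a, D, K, c, b, P, theta; split=> //; last by move=> j /allgood [].
split=> //.
- by rewrite /D big_ord0.
- by move=> j jn; apply: KS => //; apply: allgood => //; apply: ltnW.
- move=> j jn; have [i ij|//] := wt_eq j jn; apply: allgood.
  exact: leq_trans ij (ltnW jn).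
- by move=> j /allgood [].
Qed.

Variables (a D K c : nat -> nat) (b : nat -> nat -> nat).
Variables (P : nat -> {poly {poly k}}) (theta : nat -> k).
Hypothesis ks : key_system n d a D K c b P theta.
Hypothesis KE : forall j, (j <= n)%N -> K j = value (P j).
Hypothesis gE : forall j, (j <= n)%N -> at_p (P j) = g j.+1 / fx k ^+ D j.

Lemma delta_key j : (j <= n)%N -> - nu (g j.+1) = (D j * d)%:Z - (K j)%:Z.
Proof.
move=> jn; rewrite KE //; apply: nu_scaled; last exact: gE.
exact: at0_neq0 (key_at0 ks jn).
Qed.

(** By descending induction, as a_j K_j < K_(j+1) <= D_(j+1) d = a_j D_j d. *)
Lemma key_value_le j : (K n <= D n * d)%N -> (j <= n)%N -> (K j <= D j * d)%N.
Proof.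
move=> Kn jn; rewrite -(subKn jn); elim: (n - j)%N (leq_subr j n) => [|m IH] mn.
  by rewrite subn0.
have := IH (ltnW mn); set i := (n - m.+1)%N.
have -> : (n - m = i.+1)%N by rewrite /i; lia.
have i_n : (i < n)%N by rewrite /i; lia.
have := key_wtS ks i_n; rewrite (key_degS ks i_n) => h1 h2.
have : (a i * K i <= a i * (D i * d))%N by rewrite mulnA; lia.
by rewrite leq_pmul2l // (key_a_gt0 ks).
Qed.

Lemma key_monomial (m : 'X_{1..n.+2}) :
  let e i := m (inord i.+1) in
  \prod_(i < n.+2) g i ^+ m i = fx k ^+ (m ord0 + wsum n D e) * at_p (key_mon n P e).
Proof.
move=> e; have [_ [_ [_ [_ [g0 _] _ _ _]]]] := hg.
rewrite big_ord_recl /= g0 exprD -mulrA; congr (_ * _).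
rewrite at_p_prod /wsum -prodrXr -big_split; apply: eq_bigr => i _ /=.
rewrite /bump leq0n add1n at_pX gE ?leq_ord // -/(e i).
have -> : m (lift ord0 i) = e i by congr (m _); apply: val_inj; rewrite /= inordK // ltnS.
by rewrite mulnC exprM -exprMn mulrC divfK // expf_neq0 // fx_neq0.
Qed.

Lemma key_weight N (m : 'X_{1..n.+2}) :
  let e i := m (inord i.+1) in
  Bweight (fun j => - nu (g j)) N m =
    (m ord0 + wsum n D e)%N%:Z * d%:Z - (wsum n K e)%:Z - N%:Z * d%:Z.
Proof.
move=> e; have [_ [_ [_ [_ [g0 _] _ _ _]]]] := hg.
rewrite /Bweight big_ord_recl /= g0 nu_fx.
have -> : \sum_(i < n.+1) - nu (g (bump 0 i)) *+ m (lift ord0 i) =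
    (wsum n D e)%:Z * d%:Z - (wsum n K e)%:Z.
  rewrite /wsum !(big_morph Posz PoszD (erefl _)) mulr_suml -sumrB; apply: eq_bigr => i _.
  rewrite /bump leq0n add1n delta_key ?leq_ord //.
  have -> : m (lift ord0 i) = e i by congr (m _); apply: val_inj; rewrite /= inordK // ltnS.
  by rewrite -mulr_natr natz !PoszM; ring.
have intn (x : int) (y : nat) : x *+ y = x * y%:Z by rewrite -mulr_natr natz.
by rewrite !intn PoszD; ring.
Qed.

(** The expression of least weight writes [f] in monomials of value at least that
    of [f], once the negative powers of [v] are cleared by a factor [v ^ M]; then [v ^ M] is
    removed from the normal form. *)
Lemma value_normal_form (f : {poly {poly k}}) : f != 0 -> normal_form n d a D K P (value f) f.
Proof.
move=> f0; have [_ [_ [_ [_ _ _ _ P3]]]] := hg.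
have h0 : at_p f != 0 by rewrite at_p_eq0.
have [_ [N [Q [eQ [Qw _]]]]] := P3 _ (laurent_at_p f) h0.
have nuf : - nu (at_p f) = - (value f)%:Z.
  by rewrite (@nu_scaled f 0) // ?mul0n ?sub0r // expr0 divr1.
pose e (m : 'X_{1..n.+2}) i := m (inord i.+1).
pose E (m : 'X_{1..n.+2}) := (m ord0 + wsum n D (e m))%N.
pose M := (\sum_(m <- msupp Q) E m)%N.
have EM m : m \in msupp Q -> (E m <= M)%N.
  by move=> mQ; rewrite /M (big_rem m) //= leq_addr.
have VMf : 'X%:P ^+ M * f = \sum_(m <- msupp Q)
    (Q@_m)%:P%:P * 'X%:P ^+ (M + N - E m) * key_mon n P (e m).
  apply: at_p_inj; rewrite at_pM at_pXv at_p_bigsum -eQ /Beval /mmap !mulr_sumr.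
  apply: eq_big_seq => m mQ; rewrite !at_pM at_p_c at_pXv /mmap1 key_monomial -/(e m) -/(E m).
  by apply: gather_powers (fx_neq0 k) _; apply: leq_trans (EM m mQ) (leq_addr _ _).
apply: (normal_form_peelX ks (M := M)); rewrite VMf big_seq.
apply: normal_form_sum => m mQ.
apply: normal_form_mono (normal_formZ _ _ (normal_form_mon ks (e m))).
have := Qw m mQ; rewrite nuf key_weight -/(e m) -/(E m).
have le : (E m * d <= (M + N) * d)%N.
  by rewrite leq_mul2r (leq_trans (EM m mQ) (leq_addr _ _)) orbT.
move: le; rewrite -!PoszM mulnBl mulnDl.
by move: (M * d)%N (N * d)%N (E m * d)%N (wsum _ _ _) (value f) => *; lia.
Qed.

Theorem key_form_sign phi (d0 : nat) : general_curvette pts phi ->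
  intersection_multiplicity (line_at_infinity k) phi d0 ->
  0 <= - nu (g n.+1) <-> (last_maximal_contact_value pts phi <= d0 ^ 2)%N.
Proof.
move=> gphi /intersection_multiplicityC hd.
have [S [SL [_ phi0 ordphi ineq]]] := general_curvette_data gphi.
have gvE : germ_of_poly 'X%:P = axis k false by rewrite germ_of_poly_v.
have dE : multiplicity (Defs.total (axis k false) pts) = d by rewrite /value gvE.
have ordL := ordphi _ SL; rewrite dE in ordL.
have -> : d0 = d by apply: hasorder_uniq ordL; apply: (intersection_axis (b := false)).
rewrite /last_maximal_contact_value ord_EmE; set mu := multiplicity _.
have dpos := d_gt0.
rewrite delta_key // subr_ge0 lez_nat.
split=> [Kn|mud]; last first.
  (* The inequality for the germ of P_n, which meets L with multiplicity D_n. *)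
  have P0 : P n != 0 := at0_neq0 (key_at0 ks (leqnn n)).
  have := ineq false (germ_of_poly (P n)) (D n) SL.
  rewrite germ_of_poly_eq0 dE -/mu -/(value (P n)) -KE // => /(_ P0) h.
  have : (K n * d <= D n * mu)%N.
    apply: h; have coefP i : (P n)`_i`_0 = (i == D n)%:R.
      have := congr1 (fun p : {poly k} => p`_i) (key_at0 ks (leqnn n)).
      by rewrite /at0 coef_map /= /horner_eval horner_coef0 coefXn.
    split=> [i lt|]; rewrite /restr /swap /= coefP ?eqxx ?oner_neq0 //.
    by rewrite (ltn_eqF lt).
  move=> h1; have : (K n * d <= D n * d * d)%N.
    apply: leq_trans h1 _; by rewrite -mulnA leq_mul2l mulnn mud orbT.
  by rewrite leq_pmul2r.
rewrite leqNgt; apply/negP => mud.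
(* Large enough to keep both the value above d ^ 2 and the coefficient of u ^ d. *)
pose M := (d ^ 2 + d).+1; pose f := truncate M phi.
have fd0 : f`_d`_0 != 0.
  rewrite coef_truncate; [|by rewrite /M; lia|by rewrite /M; lia].
  by case: ordL => _; rewrite /restr swapE.
have f0 : f != 0 by apply: contra fd0 => /eqP ->; rewrite !coef0.
have vf : (d ^ 2 < value f)%N.
  by apply: value_truncate; rewrite ?germ_of_poly_eq0 // /M ltnS leq_addr.
have fat0 : (at0 f)`_d != 0 by rewrite /at0 coef_map /= /horner_eval horner_coef0.
have := normal_form_bound ks (value_normal_form f0) fat0.
rewrite leqNgt => /negP; apply; apply: leq_ltn_trans vf.
have -> : (d ^ 2 = wsum n D (digits n a D d) * d)%N by rewrite (deg_digits ks) mulnn.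
rewrite /wsum big_distrl /=; apply: leq_sum => i _; rewrite -mulnA leq_mul2l.
by rewrite key_value_le ?orbT ?leq_ord.
Qed.

End KeyForms.

Theorem corollary2 (R : realType) (pts : seq (option R[i]))
    (nu : funfield R[i] -> int) (hnu : divisorial_valuation pts nu)
    (phi : germ R[i]) (hphi : general_curvette pts phi)
    (d : nat)
    (hd : intersection_multiplicity (line_at_infinity R[i]) phi d)
    (n : nat) (g : nat -> funfield R[i]) (hg : key_forms nu n g) :
  0 <= - nu (g n.+1) <-> (d ^ 2 >= last_maximal_contact_value pts phi)%N.
Proof.
have [a [D [K [c [b [P [theta [ks KE gE]]]]]]]] := key_system_exists hnu hg.
exact: (key_form_sign hnu hg ks KE gE hphi hd).
Qed.
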